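(* There is an absolute constant $c>0$ such that every finite simple graph $G$ with degree sequence $d_1,\dots,d_n$ satisfies $\mathrm{cw}(G)\le c\sqrt{\mathrm{pcr}(G)+\mathrm{ssqd}(G)}$, where $\mathrm{ssqd}(G)=\sum_{k=1}^n d_k^2$.
   Context: A drawing of a graph $G$ maps vertices to distinct points of the plane and edges to simple continuous curves joining the images of their endpoints and passing through no other vertex point; any two curves share only finitely many points, no two are tangent, and no three curves pass through a common point. The pair crossing number $\mathrm{pcr}(G)$ is the minimum, over all drawings of $G$, of the number of unordered pairs of edges that cross. The cutwidth $\mathrm{cw}(G)$ of a graph on $n$ vertices is the least integer $\ell$ for which there is an ordering $v_1,\dots,v_n$ of its vertices such that for every $1\le i\le n-1$ the number of edges with one endpoint in $\{v_1,\dots,v_i\}$ and the other in $\{v_{i+1},\dots,v_n\}$ is at most $\ell$. *)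

(* Defs.v *)
From HB Require Import structures.
From mathcomp Require Import all_boot all_order all_algebra.
From mathcomp Require Import all_classical all_reals all_analysis.
Set Implicit Arguments.
Unset Strict Implicit.
Unset Printing Implicit Defensive.
Import Order.TTheory GRing.Theory Num.Theory.
Import numFieldNormedType.Exports.

Local Open Scope nat_scope.

Record sgraph := SGraph {
  vertex :> finType;
  adj : rel vertex;
  adj_sym : symmetric adj;
  adj_irr : irreflexive adj }.

Section Graph.
Variable G : sgraph.

Definition edges : {set {set G}} :=
  [set A : {set G} | [exists x, exists y, adj x y && (A == [set x; y])]].

Definition deg (x : G) : nat := #|[set y | adj x y]|.

Definition ssqd : nat := \sum_(x : G) deg x ^ 2.

Definition cut_size (S : {set G}) : nat :=
  #|[set A in edges | [exists x in A, x \in S] && [exists y in A, y \notin S]]|.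

(* [o] enumerates all the vertices without repetition; with indices starting
   at 0, [[set o j | j : 'I_#|G| & j < i]] consists of the first [i] ones. *)
Definition cutwidth_le (l : nat) : bool :=
  [exists o : {ffun 'I_#|G| -> G},
    injectiveb o &&
    [forall i : 'I_#|G|, (0 < i) ==> (cut_size [set o j | j : 'I_#|G| & j < i] <= l)]].

Lemma cutwidth_le_exists : exists l, cutwidth_le l.
Proof.
exists #|edges|; apply/existsP; exists [ffun i => enum_val i]; apply/andP; split.
  by apply/injectiveP => i j; rewrite !ffunE => /enum_val_inj.
apply/forallP => i; apply/implyP => _; apply: subset_leq_card.
by apply/fintype.subsetP => A; rewrite inE => /andP[].
Qed.

Definition cutwidth : nat := ex_minn cutwidth_le_exists.

End Graph.

Local Open Scope ring_scope.
Local Open Scope classical_set_scope.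

Section Drawing.
Variable R : realType.

(* [C] and [D] properly cross at [p], i.e. they meet at [p] and are not tangent
   there: a homeomorphism [h] between an open neighborhood [U] of [p] and an
   open neighborhood [V] of the origin, with inverse [k], straightens [C] and
   [D] to the two coordinate axes. *)
Definition cross_at (C D : set (R * R)) (p : R * R) : Prop :=
  exists (U V : set (R * R)) (h k : R * R -> R * R),
    [/\ open_nbhs p U, open_nbhs (0, 0) V & h p = (0, 0)] /\
    [/\ set_fun U V h, set_fun V U k, {in U, cancel h k} & {in V, cancel k h}] /\
    [/\ {within U, continuous h}, {within V, continuous k},
        (forall q, U q -> (C q <-> (h q).2 = 0)) &
        (forall q, U q -> (D q <-> (h q).1 = 0))].

Definition arc_of (f : R -> R * R) : set (R * R) := f @` `[0, 1].

Definition open_arc_of (f : R -> R * R) : set (R * R) := f @` `]0, 1[.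

(* The values of [curve] outside [edges G] or outside [0, 1] are irrelevant.
   As curves avoid foreign vertex points, a common point of two curves which
   is not the image of a common endpoint lies on both open arcs. *)
Record drawing (G : sgraph) := Drawing {
  vertex_point : G -> R * R;
  curve : {set G} -> R -> R * R;
  vertex_point_inj : injective vertex_point;
  curve_cont : forall A, A \in edges G -> {within `[0, 1], continuous (curve A)};
  curve_simple : forall A, A \in edges G -> {in `[0, 1] &, injective (curve A)};
  curve_ends : forall A, A \in edges G ->
    exists x y : G, [/\ A = [set x; y]%SET, curve A 0 = vertex_point x &
                        curve A 1 = vertex_point y];
  curve_avoid : forall A x, A \in edges G -> x \notin A ->
    ~ arc_of (curve A) (vertex_point x);
  curve_finite : forall A B, A \in edges G -> B \in edges G -> A != B ->
    finite_set (arc_of (curve A) `&` arc_of (curve B));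
  curve_no_tangency : forall A B p, A \in edges G -> B \in edges G -> A != B ->
    open_arc_of (curve A) p -> open_arc_of (curve B) p ->
    cross_at (arc_of (curve A)) (arc_of (curve B)) p;
  curve_no_triple : forall A B C p,
    A \in edges G -> B \in edges G -> C \in edges G ->
    A != B -> B != C -> A != C ->
    open_arc_of (curve A) p -> open_arc_of (curve B) p ->
    ~ open_arc_of (curve C) p }.

Definition edges_cross (G : sgraph) (d : drawing G) (A B : {set G}) : Prop :=
  exists p, open_arc_of (curve d A) p /\ open_arc_of (curve d B) p.

Definition crossing_pairs (G : sgraph) (d : drawing G) : {set {set {set G}}} :=
  [set P : {set {set G}} |
    [exists A in edges G, exists B in edges G,
      [&& A != B, P == [set A; B]%SET & `[< edges_cross d A B >]]]]%SET.

Definition is_pcr (G : sgraph) (k : nat) : Prop :=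
  (exists d : drawing G, #|crossing_pairs d| = k) /\
  (forall d : drawing G, (k <= #|crossing_pairs d|)%N).

Definition pcr (G : sgraph) : nat := xget 0%N [set k | is_pcr G k].

Lemma pcrP (G : sgraph) (d : drawing G) : is_pcr G (pcr G).
Proof.
apply: (@xgetPex _ 0%N [set k | is_pcr G k]).
have ex : exists k, `[< exists d' : drawing G, #|crossing_pairs d'| = k >].
  by exists #|crossing_pairs d|; apply/asboolP; exists d.
case: (ex_minnP ex) => k /asboolP kP kmin; exists k; split=> // d'.
by apply: kmin; apply/asboolP; exists d'.
Qed.

End Drawing.

(* Main.v *)
(* The edges of a drawn graph are strings, two of which touch when they cross or
   share an endpoint; counted with multiplicity, there are
   M <= 2 pcr + ssqd pairs of touching strings.  Approximating the curves by
   walks in a fine grid keeps the touching relation under control and replaces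
   the plane by the grid, where a loop has a well defined winding parity around
   every vertex off it.

   The core is a Lipton-Tarjan argument for strings: a family of strings with M
   touching pairs has a separator of O(sqrt M) strings.  A string u gets the
   length w u, the number of strings touching it, and strings are layered by
   their weighted distance to a root.  Since the w u sum up to M, among any
   sqrt M consecutive levels one is met by at most sqrt M strings, and a
   shortest path crossing sqrt M levels touches at most O(sqrt M) strings.
   If there were no small separator, every small set Z of strings would leave a
   large component beta Z.  Joining each grid vertex x to the root by a walk
   along a shortest path, and calling D x the strings met by it between two
   thin levels, consider, for a grid edge xy, the parity eps xy with which the
   loop root-x-y-root winds around beta (D x :|: D y).  The sum of eps over the
   sides of each unit square vanishes, because the four loops add up to the
   square, which no string of the large component meets; but the sum over the
   border of the whole grid is 1, a contradiction.

   Separating recursively gives a vertex ordering all of whose cuts have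
   O(sqrt M) edges.  Finally, the junk value pcr = 0 for graphs without drawing
   must be excluded: straight chords between points of a parabola whose
   abscissas grow fast enough have no three concurrent members. *)

Require Import Defs.
From mathcomp Require Import all_boot zify.
From mathcomp Require Import boolp.
Set Implicit Arguments.
Unset Strict Implicit.
Unset Printing Implicit Defensive.
Local Open Scope nat_scope.

(** * Parity of crossings of walks in the grid *)

Definition gadj (x y : nat * nat) : bool :=
  ((x.1 == y.1) && ((x.2.+1 == y.2) || (y.2.+1 == x.2)))
  || ((x.2 == y.2) && ((x.1.+1 == y.1) || (y.1.+1 == x.1))).

Lemma gadj_sym : symmetric gadj.
Proof.
move=> x y; rewrite /gadj [x.1 == y.1]eq_sym [x.2 == y.2]eq_sym.
by congr (_ && _ || _ && _); rewrite orbC.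
Qed.

(* The step from [x] to [y] crosses the ray going left from [v + (1/2, 1/2)]. *)
Definition step_cross (v x y : nat * nat) : bool :=
  (x.1 <= v.1) && ((x.2 <= v.2) (+) (y.2 <= v.2)).

Fixpoint walk_cross v x p : bool :=
  if p is y :: p' then step_cross v x y (+) walk_cross v y p' else false.

Lemma gadjP x y : gadj x y ->
  [\/ y = (x.1, x.2.+1), x = (y.1, y.2.+1), y = (x.1.+1, x.2) | x = (y.1.+1, y.2)].
Proof.
case: x y => [x1 x2] [y1 y2]; rewrite /gadj /=.
by case/orP => /andP[/eqP-> /orP[]/eqP<-]; [apply: Or41|apply: Or42|apply: Or43|apply: Or44].
Qed.

Lemma leq_succ_addb a n : (a <= n) (+) (a.+1 <= n) = (a == n).
Proof. by rewrite (leq_eqVlt a); case: eqP => [->|_]; rewrite ?ltnn ?addbb. Qed.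

(** Moving the ray from [(i, j)] to [(i.+1, j)] lengthens it across one more vertical edge, and a
    step along that edge visits [(i.+1, j)]. *)
Lemma step_cross_hor i j x y : gadj x y -> x != (i.+1, j) -> y != (i.+1, j) ->
  step_cross (i, j) x y = step_cross (i.+1, j) x y.
Proof.
case: x y => [x1 x2] [y1 y2] /gadjP; rewrite /step_cross -!pair_eqE /=.
rewrite (leq_eqVlt x1 i.+1) ltnS.
case=> -[-> ->] /=; rewrite ?leq_succ_addb ?(addbC (_ < _)) ?leq_succ_addb ?addbb ?andbF //.
- by case: (x1 == i.+1); case: (x2 == j); rewrite ?andbF.
- by case: (y1 == i.+1); case: (y2 == j); rewrite ?andbF ?implybF.
Qed.

(** The two rays bound a half-strip whose grid vertices are the [(k, j.+1)] with [k <= i]. A step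
    changes side by crossing one of the rays; leaving through the open end would use the excluded
    vertex [(i, j.+1)]. *)
Lemma step_cross_ver i j x y : gadj x y -> x != (i, j.+1) -> y != (i, j.+1) ->
  step_cross (i, j) x y (+) step_cross (i, j.+1) x y =
  ((x.1 <= i) && (x.2 == j.+1)) (+) ((y.1 <= i) && (y.2 == j.+1)).
Proof.
case: x y => [x1 x2] [y1 y2] /gadjP; rewrite /step_cross -!pair_eqE /=.
case=> -[-> ->] /= h h'.
- by rewrite !leq_succ_addb eqSS -!andb_addr [X in _ && X]addbC.
- by rewrite !(addbC (_ < _)) !leq_succ_addb eqSS -!andb_addr.
- move: h; rewrite !addbb (leq_eqVlt x1).
  by case: (x1 =P i) => [->|_ _] /=; rewrite ?addbb // ltnn => /negPf->.
- move: h'; rewrite !addbb (leq_eqVlt y1).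
  by case: (y1 =P i) => [->|_ _] /=; rewrite ?addbb // ltnn => /negPf->.
Qed.

(** The change of parity is a coboundary: [phi] indicates the vertices between the two rays, and is
    zero when [v] and [v'] lie in the same row. It therefore cancels along closed walks. *)
Lemma walk_cross_shift v v' : gadj v v' -> exists phi : nat * nat -> bool,
  forall x p, path gadj x p -> v \notin x :: p -> v' \notin x :: p ->
  walk_cross v x p (+) walk_cross v' x p = phi x (+) phi (last x p).
Proof.
have hor i j : exists phi : nat * nat -> bool,
    forall x p, path gadj x p -> (i.+1, j) \notin x :: p ->
    walk_cross (i, j) x p (+) walk_cross (i.+1, j) x p = phi x (+) phi (last x p).
  exists xpred0 => x p; elim: p x => [//|y p IH] x /= /andP[xy yp].
  rewrite inE negb_or => /andP[xv yv].
  have := IH _ yp yv; rewrite /= => E.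
  rewrite addbACA E addbF; move: xv yv; rewrite inE negb_or ![(_, _) == _]eq_sym => xv /andP[yv _].
  by rewrite (step_cross_hor xy xv yv) addbb.
have ver i j : exists phi : nat * nat -> bool,
    forall x p, path gadj x p -> (i, j.+1) \notin x :: p ->
    walk_cross (i, j) x p (+) walk_cross (i, j.+1) x p = phi x (+) phi (last x p).
  exists (fun q => (q.1 <= i) && (q.2 == j.+1)) => x p.
  elim: p x => [|y p IH] x /=; first by rewrite addbb.
  move=> /andP[xy yp]; rewrite inE negb_or => /andP[xv yv].
  have := IH _ yp yv; rewrite /= => E.
  move: xv yv; rewrite inE negb_or ![(_, _) == _]eq_sym => xv /andP[yv _].
  by rewrite addbACA E (step_cross_ver xy xv yv) addbA addbK.
case: v v' => [i j] [i' j']; move=> /gadjP /= [] [-> ->].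
- by have [f fP] := ver i j; exists f => x p xp _; apply: fP.
- by have [f fP] := ver i' j'; exists f => x p xp h1 _; rewrite addbC; apply: fP.
- by have [f fP] := hor i j; exists f => x p xp _; apply: fP.
- by have [f fP] := hor i' j'; exists f => x p xp h1 _; rewrite addbC; apply: fP.
Qed.

Section Loop.
Variables (root : nat * nat) (p : nat * nat -> seq (nat * nat)).

(* The winding parity around [v] of the closed walk going from [x] to the root,
   back to [y] and then to [x]. *)
Definition loop_cross (x y v : nat * nat) : bool :=
  walk_cross v x (p x) (+) walk_cross v y (p y) (+) step_cross v x y.

Hypothesis p_walk : forall x, path gadj x (p x).
Hypothesis p_last : forall x, last x (p x) = root.

Lemma loop_cross_shift x y v v' : gadj x y -> gadj v v' ->
  v \notin x :: p x -> v' \notin x :: p x ->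
  v \notin y :: p y -> v' \notin y :: p y ->
  loop_cross x y v = loop_cross x y v'.
Proof.
move=> xy vv' vx v'x vy v'y.
have [phi phiP] := walk_cross_shift vv'.
have Ex := phiP _ _ (p_walk x) vx v'x.
have Ey := phiP _ _ (p_walk y) vy v'y.
have xyp : path gadj x [:: y] by rewrite /= xy.
have vxy : v \notin [:: x; y].
  by move: vx vy; rewrite !inE !negb_or => /andP[-> _] /andP[-> _].
have v'xy : v' \notin [:: x; y].
  by move: v'x v'y; rewrite !inE !negb_or => /andP[-> _] /andP[-> _].
have := phiP _ _ xyp vxy v'xy; rewrite /= !addbF => Exy.
move: Ex Ey Exy; rewrite !p_last /loop_cross.
move: (walk_cross v x _) (walk_cross v y _) (step_cross v x y) => a b c.
move: (walk_cross v' x _) (walk_cross v' y _) (step_cross v' x y) => a' b' c'.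
move: (phi x) (phi y) (phi root).
by case: a; case: b; case: c; case: a'; case: b'; case: c'; do 3!case.
Qed.

Lemma loop_cross_walk x y v q : gadj x y -> path gadj v q ->
  (forall z, z \in v :: q -> z \notin x :: p x) ->
  (forall z, z \in v :: q -> z \notin y :: p y) ->
  forall z, z \in v :: q -> loop_cross x y z = loop_cross x y v.
Proof.
move=> xy; elim: q v => [|v' q IH] v /=.
  by move=> _ _ _ z; rewrite inE => /eqP->.
move=> /andP[vv' qP] hx hy z.
have tl u : u \in v' :: q -> u \in [:: v, v' & q] by move=> h; rewrite inE h orbT.
rewrite inE => /orP[/eqP-> //|zq].
rewrite (IH v' qP _ _ z zq); last 2 first.
- by move=> u /tl; apply: hx.
- by move=> u /tl; apply: hy.
apply: loop_cross_shift => //; rewrite 1?gadj_sym //.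
all: by [apply: hx; rewrite !inE eqxx ?orbT | apply: hy; rewrite !inE eqxx ?orbT].
Qed.

(** The walks to the root occur twice each and cancel, which leaves the boundary of a unit square.
    Its center is [v + (1/2, 1/2)] only for the lower left corner [v]. *)
Lemma square_loops a b v :
  loop_cross (a, b) (a.+1, b) v (+) loop_cross (a, b.+1) (a.+1, b.+1) v
  (+) (loop_cross (a, b) (a, b.+1) v (+) loop_cross (a.+1, b) (a.+1, b.+1) v)
  = (v == (a, b)).
Proof.
have E : step_cross v (a, b) (a.+1, b) (+) step_cross v (a, b.+1) (a.+1, b.+1)
  (+) (step_cross v (a, b) (a, b.+1) (+) step_cross v (a.+1, b) (a.+1, b.+1))
  = (v == (a, b)).
  case: v => i j; rewrite /step_cross -pair_eqE /= !addbb -andb_addl !leq_succ_addb.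
  by rewrite (eq_sym a) (eq_sym b).
rewrite -E /loop_cross; move: (walk_cross v (a, b) _) (walk_cross v (a.+1, b) _).
move: (walk_cross v (a, b.+1) _) (walk_cross v (a.+1, b.+1) _).
by move: (step_cross _ _ _) (step_cross _ _ _) (step_cross _ _ _) (step_cross _ _ _);
  do 8![case].
Qed.

End Loop.

Definition touch (T : finType) (S : T -> seq (nat * nat)) : rel T :=
  [rel u v | has [in S v] (S u)].

Lemma touch_sym (T : finType) (S : T -> seq (nat * nat)) : symmetric (touch S).
Proof. by move=> u v; apply/hasP/hasP => -[z zu zv]; exists z. Qed.

Definition is_string (s : seq (nat * nat)) : bool := (s != [::]) && sorted gadj s.

Lemma big_addb_telescope n (f : nat -> bool) :
  \big[addb/false]_(i < n) (f i (+) f i.+1) = f 0 (+) f n.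
Proof.
elim: n => [|n IH]; first by rewrite big_ord0 addbb.
by rewrite big_ord_recr /= IH addbA addbK.
Qed.

Lemma cardsU_leq (T : finType) (A B : {set T}) : #|A :|: B| <= #|A| + #|B|.
Proof. exact: leq_card_setU. Qed.

(** * Havens of strings in the grid *)

Section GridHaven.
Variables (T : finType) (S : T -> seq (nat * nat)) (N K : nat) (root : nat * nat)
  (p : nat * nat -> seq (nat * nat)) (D : nat * nat -> {set T})
  (beta : {set T} -> {set T}).
Hypothesis p_walk : forall x, path gadj x (p x).
Hypothesis p_last : forall x, last x (p x) = root.
Hypothesis S_string : forall u, is_string (S u).
Hypothesis S_inner : forall u (z : nat * nat), z \in S u -> [&& 0 < z.1, z.1 < N, 0 < z.2 & z.2 < N].
(** The factor 4 lets the sets of the four corners of a unit square fit together in [K]. *)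
Hypothesis D_card : forall x, 4 * #|D x| <= K.
Hypothesis D_border : forall x : nat * nat,
  [|| x.1 == 0, x.1 == N, x.2 == 0 | x.2 == N] -> D x = D (0, 0).
Hypothesis D_avoid : forall x (Z : {set T}) u (z : nat * nat), #|Z| <= K -> D x \subset Z ->
  u \in beta Z -> z \in S u -> z \notin x :: p x.
Hypothesis beta_neq0 : forall Z : {set T}, #|Z| <= K -> beta Z != set0.
Hypothesis beta_sub : forall Y Z : {set T}, #|Z| <= K -> Y \subset Z -> beta Z \subset beta Y.
Hypothesis beta_conn : forall Z : {set T}, #|Z| <= K -> {in beta Z &, forall u v,
  connect [rel a b | [&& a \in beta Z, b \in beta Z & touch S a b]] u v}.

(** A sample point on a string of the haven, where winding parities are read off. The default values
    are never met when [#|Z| <= K]. *)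
Let pt (Z : {set T}) : nat * nat := if [pick u in beta Z] is Some u then head (0, 0) (S u) else (0, 0).

Let ptP (Z : {set T}) : #|Z| <= K -> exists2 u, u \in beta Z & pt Z \in S u.
Proof.
move=> ZK; rewrite /pt; case: pickP => [u uZ|Z0].
  by exists u => //; case: (S u) (S_string u) => [//|a s] _; rewrite inE eqxx.
by case/set0Pn: (beta_neq0 ZK) => u; have := Z0 u; rewrite /= => ->.
Qed.

Let loop := loop_cross p.
Let eps x y := loop x y (pt (D x :|: D y)).

Let string_const x y u z z' : gadj x y -> 
  (forall z, z \in S u -> z \notin x :: p x) ->
  (forall z, z \in S u -> z \notin y :: p y) ->
  z \in S u -> z' \in S u -> loop x y z = loop x y z'.
Proof.
move=> xy; case/andP: (S_string u); case: (S u) => [//|v q] _ vq hx hy zS z'S.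
have h := loop_cross_walk p_walk p_last xy vq hx hy.
by rewrite /loop (h z zS) (h z' z'S).
Qed.

Let D2_card x y : #|D x :|: D y| <= K.
Proof.
apply: leq_trans (cardsU_leq _ _) _; have := D_card x; have := D_card y; lia.
Qed.

(** The strings of [beta (D x :|: D y)] form a connected family that avoids the loop, so the loop
    winds equally around all their points; this family contains [beta Z]. *)
Let eps_eq x y (Z : {set T}) u z : gadj x y -> #|Z| <= K -> D x :|: D y \subset Z ->
  u \in beta Z -> z \in S u -> loop x y z = eps x y.
Proof.
move=> xy ZK DZ uZ zu; rewrite /eps.
set Z' := D x :|: D y; have Z'K : #|Z'| <= K := D2_card x y.
have uZ' : u \in beta Z' by apply: subsetP uZ; apply: beta_sub.
have [u' u'Z' u'S] := ptP Z'K.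
have hx v : v \in beta Z' -> forall z, z \in S v -> z \notin x :: p x.
  by move=> vZ z' z'S; apply: D_avoid vZ z'S => //; apply: subsetUl.
have hy v : v \in beta Z' -> forall z, z \in S v -> z \notin y :: p y.
  by move=> vZ z' z'S; apply: D_avoid vZ z'S => //; apply: subsetUr.
have /connectP[q] := beta_conn Z'K uZ' u'Z'.
elim: q u uZ' z {uZ} zu => [|v q IH] u uZ' z zu /=.
  move=> _ E; subst u'; apply: string_const zu u'S => //; [exact: hx|exact: hy].
move=> /andP[/and3P[_ vZ /hasP[z' z'u z'v]] vq] E.
rewrite -(IH v vZ z' z'v vq E).
by apply: string_const zu z'u => //; [exact: hx|exact: hy].
Qed.

(** For [Z] the union of the four sets, one point of [beta Z] computes all four parities. Their sum
    could be 1 only if that point were [(a, b)], which starts its own walk to the root and is thus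
    avoided. *)
Let eps_square a b :
  eps (a, b) (a.+1, b) (+) eps (a, b.+1) (a.+1, b.+1)
  (+) (eps (a, b) (a, b.+1) (+) eps (a.+1, b) (a.+1, b.+1)) = false.
Proof.
pose Z := D (a, b) :|: D (a.+1, b) :|: (D (a, b.+1) :|: D (a.+1, b.+1)).
have ZK : #|Z| <= K.
  apply: leq_trans (cardsU_leq _ _) _.
  have := cardsU_leq (D (a, b)) (D (a.+1, b)).
  have := cardsU_leq (D (a, b.+1)) (D (a.+1, b.+1)).
  have := D_card (a, b); have := D_card (a.+1, b).
  have := D_card (a, b.+1); have := D_card (a.+1, b.+1); lia.
have [u uZ uS] := ptP ZK.
have D1 : D (a, b) \subset Z by rewrite /Z -setUA subsetUl.
have D2 : D (a.+1, b) \subset Z by rewrite /Z -setUA setUCA subsetUl.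
have D3 : D (a, b.+1) \subset Z by rewrite /Z setUCA subsetUl.
have D4 : D (a.+1, b.+1) \subset Z by rewrite /Z setUA subsetUr.
rewrite -!(eps_eq _ ZK _ uZ uS) ?subUset ?D1 ?D2 ?D3 ?D4 //.
rewrite /loop square_loops; apply/negP => /eqP E.
by have := D_avoid ZK D1 uZ uS; rewrite E inE eqxx.
all: by rewrite /gadj /= !eqxx ?orbT.
Qed.

Lemma no_grid_haven : False.
Proof.
have Dc : #|D (0, 0)| <= K by have := D_card (0, 0); lia.
have [u uZ uS] := ptP Dc; set v := pt (D (0, 0)) in uS.
have vN := S_inner uS.
(* All sets [D] agree on the border, so the single point [v] computes every parity there. *)
have epsE x y : gadj x y -> [|| x.1 == 0, x.1 == N, x.2 == 0 | x.2 == N] ->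
    [|| y.1 == 0, y.1 == N, y.2 == 0 | y.2 == N] -> eps x y = loop x y v.
  by move=> xy bx by_; rewrite -(eps_eq xy Dc _ uZ uS) // !D_border // setUid.
pose H i j := eps (i, j) (i.+1, j); pose V i j := eps (i, j) (i, j.+1).
have : \big[addb/false]_(i < N) \big[addb/false]_(j < N)
    (H i j (+) H i j.+1 (+) (V i j (+) V i.+1 j)) = false.
  by rewrite big1 // => i _; rewrite big1 // => j _; apply: eps_square.
(* Interior edges belong to two squares and cancel; the four sides of the grid remain. *)
under eq_bigr => i _ do rewrite big_split /= (big_addb_telescope N (H i)).
rewrite big_split /= [X in _ (+) X]exchange_big /=.
under [X in _ (+) X]eq_bigr => j _ do rewrite (big_addb_telescope N (V^~ j)).
pose W x := walk_cross v x (p x).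
have hh j : (j == 0) || (j == N) -> \big[addb/false]_(i < N) H i j = W (0, j) (+) W (N, j).
  move=> hj; rewrite -(big_addb_telescope N (fun i => W (i, j))).
  apply: eq_bigr => i _; rewrite /H epsE /gadj /= ?eqxx ?orbT // ?hj ?orbT //.
  by rewrite /loop /loop_cross /step_cross /= addbb andbF addbF.
have hv i : (i == 0) || (i == N) ->
    \big[addb/false]_(j < N) V i j = W (i, 0) (+) W (i, N) (+) (i <= v.1).
  move=> hi; rewrite -(big_addb_telescope N (fun j => W (i, j))).
  have -> : (i <= v.1) = \big[addb/false]_(j < N)
      (((i <= v.1) && (j <= v.2)) (+) ((i <= v.1) && (j.+1 <= v.2))).
    rewrite (big_addb_telescope N (fun j => (i <= v.1) && (j <= v.2))) /=.
    by case/and4P: vN => _ _ _; rewrite ltnNge => /negPf->; rewrite andbT andbF addbF.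
  rewrite -big_split; apply: eq_bigr => j _; rewrite /V epsE /gadj /= ?eqxx ?orbT //.
  - by rewrite /loop /loop_cross /step_cross /= -andb_addr.
  - by case/orP: hi => ->; rewrite ?orbT.
  - by case/orP: hi => ->; rewrite ?orbT.
rewrite big_split /= [X in _ (+) X]big_split /= !hh ?hv ?eqxx ?orbT //.
(* Each corner term [W] occurs twice. The ray going left from [v] crosses the side [i = 0] once and
   no other side, so the sum is 1. *)
case/and4P: vN => v0 vN _ _; rewrite leq0n leqNgt vN.
by move: (W (0, 0)) (W (N, 0)) (W (0, N)) (W (N, N)); do 4!case.
Qed.

End GridHaven.

(** * Separators of string graphs *)

Definition walk_in (P : nat * nat -> Prop) (x y : nat * nat) : Prop :=
  exists p, [/\ path gadj x p, last x p = y & forall z, z \in x :: p -> P z].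

Lemma walk_in_refl (P : nat * nat -> Prop) x : P x -> walk_in P x x.
Proof. by move=> Px; exists [::]; split=> // z; rewrite inE => /eqP->. Qed.

Lemma walk_in_step (P : nat * nat -> Prop) x y z :
  P x -> gadj x y -> walk_in P y z -> walk_in P x z.
Proof.
move=> Px xy [p [yp lp hp]]; exists (y :: p); split=> //=; first by rewrite xy.
by move=> t; rewrite inE => /orP[/eqP->|/hp].
Qed.

Lemma walk_in_trans (P : nat * nat -> Prop) x y z :
  walk_in P x y -> walk_in P y z -> walk_in P x z.
Proof.
move=> [p [xp <- hp]] [q [pq <- hq]]; exists (p ++ q).
rewrite cat_path xp pq last_cat; split=> // t.
rewrite -cat_cons mem_cat => /orP[/hp //|tq].
by apply: hq; rewrite inE tq orbT.
Qed.

Lemma walk_in_sub (P Q : nat * nat -> Prop) x y :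
  (forall z, P z -> Q z) -> walk_in P x y -> walk_in Q x y.
Proof. by move=> PQ [p [xp lp hp]]; exists p; split=> // z /hp/PQ. Qed.

Lemma walk_in_sym (P : nat * nat -> Prop) x y : walk_in P x y -> walk_in P y x.
Proof.
move=> [p]; elim: p x => [|z p IH] x [/= xp lp hp].
  by rewrite lp in hp *; apply: walk_in_refl; apply: hp; rewrite inE.
case/andP: xp => xz zp.
have hz : walk_in P y z by apply: IH; split=> // t h; apply: hp; rewrite inE h orbT.
apply: walk_in_trans hz _; apply: (@walk_in_step P z x).
- by apply: hp; rewrite !inE eqxx orbT.
- by rewrite gadj_sym.
- by apply: walk_in_refl; apply: hp; rewrite inE eqxx.
Qed.

Lemma string_walk s x y : is_string s -> x \in s -> y \in s -> walk_in (fun z => z \in s) x y.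
Proof.
case: s => [|a p] // /andP[_ /= ap].
have ha z : z \in a :: p -> walk_in (fun z => z \in a :: p) a z.
  elim: p a ap => [|b p IH] a /= ap.
    by rewrite inE => /eqP->; apply: walk_in_refl; rewrite inE.
  case/andP: ap => ab bp; rewrite inE => /orP[/eqP->|zb].
    by apply: walk_in_refl; rewrite inE eqxx.
  apply: (walk_in_step _ ab); first by rewrite inE eqxx.
  by apply: walk_in_sub (IH _ bp zb) => t h; rewrite inE h orbT.
by move=> hx hy; apply: walk_in_trans (ha y hy); apply/walk_in_sym/ha.
Qed.

Lemma column_walk (P : nat * nat -> Prop) i j :
  (forall k, k <= j -> P (i, k)) -> walk_in P (i, j) (i, 0).
Proof.
elim: j => [|j IH] h; first by apply: walk_in_refl; apply: h.
apply: (@walk_in_step P _ (i, j)); first exact: h.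
  by rewrite /gadj /= !eqxx orbT.
by apply: IH => k kj; apply: h; apply: leqW.
Qed.

Lemma row_walk (P : nat * nat -> Prop) i j :
  (forall k, k <= i -> P (k, j)) -> walk_in P (i, j) (0, j).
Proof.
elim: i => [|i IH] h; first by apply: walk_in_refl; apply: h.
apply: (@walk_in_step P _ (i, j)); first exact: h.
  by rewrite /gadj /= !eqxx !orbT.
by apply: IH => k kj; apply: h; apply: leqW.
Qed.

Lemma grid_walk x y : walk_in (fun=> True) x y.
Proof.
have h z : walk_in (fun=> True) z (0, 0).
  by case: z => i j; apply: walk_in_trans (column_walk _) (row_walk _).
exact: walk_in_trans (h x) (walk_in_sym (h y)).
Qed.

Lemma border_walk N x : [|| x.1 == 0, x.1 == N, x.2 == 0 | x.2 == N] ->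
  walk_in (fun z => [|| z.1 == 0, z.1 == N, z.2 == 0 | z.2 == N]) x (0, 0).
Proof.
case: x => i j /= /or4P[] /eqP->.
- by apply: column_walk => k _ /=; rewrite ?eqxx.
- apply: (@walk_in_trans _ _ (N, 0)).
    by apply: column_walk => k _ /=; rewrite ?eqxx ?orbT.
  by apply: row_walk => k _ /=; rewrite ?eqxx ?orbT.
- by apply: row_walk => k _ /=; rewrite ?eqxx ?orbT.
- apply: (@walk_in_trans _ _ (0, N)).
    by apply: row_walk => k _ /=; rewrite ?eqxx ?orbT.
  by apply: column_walk => k _ /=; rewrite ?eqxx.
Qed.

Definition inside (T : finType) (t : rel T) (X : {set T}) : rel T :=
  [rel a b | [&& a \in X, b \in X & t a b]].

(** [e u] is the least total weight of a path from [u] to [u0] inside [X], both ends counted. *)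
Lemma weighted_distance (T : finType) (t : rel T) (w : T -> nat) (X : {set T}) u0 :
  u0 \in X -> {in X, forall u, connect (inside t X) u u0} ->
  exists e : T -> nat, [/\ e u0 = w u0,
    {in X, forall u, u != u0 -> exists v, [/\ v \in X, t u v & e u = w u + e v]} &
    {in X &, forall u v, t u v -> e u <= w u + e v}].
Proof.
move=> u0X uX.
pose walk u n := exists p, [/\ path (inside t X) u p, last u p = u0 &
  \sum_(v <- u :: p) w v = n].
have ex u : exists n, u \in X -> walk u n /\ forall m, walk u m -> n <= m.
  have [uinX|_] := boolP (u \in X); last by exists 0.
  have h : exists n, `[< walk u n >].
    have /connectP[p up pu] := uX u uinX.
    by exists (\sum_(v <- u :: p) w v); apply/asboolP; exists p.
  case: (ex_minnP h) => n /asboolP hn nmin; exists n => _; split=> // m hm.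
  exact/nmin/asboolP.
have [e eP] := choice ex; exists e.
have consw u v n : u \in X -> v \in X -> t u v -> walk v n -> walk u (w u + n).
  move=> uX' vX uv [p [vp lp <-]]; exists (v :: p); split=> //=.
    by rewrite /inside /= uX' vX uv.
  by rewrite big_cons.
split.
- have [[p [_ _ E]] h] := eP u0 u0X; apply/eqP; rewrite eqn_leq.
  rewrite -{2}E big_cons leq_addr andbT; apply: h.
  by exists [::]; split=> //; rewrite big_seq1.
- move=> u uX' uu0; case: (eP u uX') => -[[|v p] [/= + + <-]] h.
    by move=> _ E; rewrite E eqxx in uu0.
  move=> /andP[/and3P[_ vX uv] vp] lp; exists v; split=> //.
  case: (eP v vX) => wv hv; apply/eqP; rewrite eqn_leq.
  rewrite (h _ (consw _ _ _ uX' vX uv wv)) /= big_cons leq_add2l hv //.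
  by exists p.
- move=> u v uX' vX uv; case: (eP u uX') => _; apply; apply: consw uv _ => //.
  by case: (eP v vX).
Qed.

(** A string of weight [k] will occupy [k] consecutive levels; this bounds how many of them fall in
    a window. *)
Lemma interval_count n c x k : \sum_(l < n) ((x <= c + l) && (c + l < x + k)) <= k.
Proof.
elim: k => [|k IH]; first by rewrite big1 // => l _; rewrite addn0; lia.
have one : \sum_(l < n) (c + l == x + k) <= 1.
  suff -> : \sum_(l < n) (c + l == x + k) = (c <= x + k) && (x + k < c + n) by apply: leq_b1.
  elim: n {IH} => [|n IH]; first by rewrite big_ord0; lia.
  by rewrite big_ord_recr /= IH; lia.
rewrite -addn1; apply: leq_trans (leq_add IH one).
by rewrite -big_split; apply: leq_sum => l _ /=; lia.
Qed.

(** * From a haven of strings to a haven in the grid *)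

Section StringHaven.
Variables (T : finType) (S : T -> seq (nat * nat)) (N r : nat) (E : {set T})
  (beta : {set T} -> {set T}).
Hypothesis S_string : forall u, is_string (S u).
Hypothesis S_inner : forall u (z : nat * nat), z \in S u ->
  [&& 0 < z.1, z.1 < N, 0 < z.2 & z.2 < N].

Definition weight (A : {set T}) (u : T) : nat := #|[set v in A | touch S u v]|.

Hypothesis r_gt0 : 0 < r.
Hypothesis weight_total : \sum_(u in E) weight E u <= r ^ 2.
(** The sets [D] built below have at most [5 * r] elements, and four of them must fit. *)
Let K := 20 * r.
Hypothesis beta_in : forall Z : {set T}, #|Z| <= K -> beta Z \subset E :\: Z.
Hypothesis beta_neq0 : forall Z : {set T}, #|Z| <= K -> beta Z != set0.
Hypothesis beta_sub : forall Y Z : {set T}, #|Z| <= K -> Y \subset Z -> beta Z \subset beta Y.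
Hypothesis beta_conn : forall Z : {set T}, #|Z| <= K -> {in beta Z &, forall u v,
  connect (inside (touch S) (beta Z)) u v}.

Let w := weight E.
(** Once these strings are removed, each remaining one touches at most [r] strings. The total weight
    [r ^ 2] allows at most [r] heavy ones. *)
Let heavy := [set u in E | r < w u].

Let touch_refl u : touch S u u.
Proof.
apply/hasP; case: (S u) (S_string u) => [//|z s] _.
by exists z; rewrite inE eqxx.
Qed.

Let heavy_card : #|heavy| <= r.
Proof.
have : #|heavy| * r.+1 <= r ^ 2.
  apply: leq_trans weight_total; rewrite -sum_nat_const.
  rewrite [X in _ <= X](bigID (mem heavy)) /=.
  apply: leq_trans (leq_addr _ _).
  rewrite [X in _ <= X](eq_bigl (mem heavy)).
    by apply: leq_sum => u; rewrite inE => /andP[].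
  by move=> u; rewrite /= inE; case: (u \in E).
by rewrite -mulnn; nia.
Qed.

Let B0 := beta heavy.

Let heavyK : #|heavy| <= K.
Proof. by rewrite (leq_trans heavy_card) // /K leq_pmull. Qed.

Let B0E u : u \in B0 -> u \in E.
Proof. by move/(subsetP (beta_in heavyK)); rewrite inE => /andP[]. Qed.

Let B0w u : u \in B0 -> 0 < w u <= r.
Proof.
move=> uB; apply/andP; split.
  by apply/card_gt0P; exists u; rewrite inE B0E //= touch_refl.
by move/(subsetP (beta_in heavyK)): uB; rewrite !inE => /andP[+ uE]; rewrite uE -leqNgt.
Qed.

Let connB0 : {in B0 &, forall u v, connect (inside (touch S) B0) u v} := beta_conn heavyK.

Section Root.
Variables (u0 : T) (e : T -> nat).
Hypothesis u0B : u0 \in B0.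
Hypothesis e_root : e u0 = w u0.
Hypothesis e_parent : {in B0, forall u, u != u0 ->
  exists v, [/\ v \in B0, touch S u v & e u = w u + e v]}.
Hypothesis e_le : {in B0 &, forall u v, touch S u v -> e u <= w u + e v}.

(** A string occupies the interval [[e u - w u, e u)], as long as its weight. By [e_le] the
    intervals of touching strings overlap or abut, so removing the strings at level [l] separates
    those below from those above. *)
Let level l := [set u in B0 | e u - w u <= l < e u].
Let cut l := heavy :|: level l.
Let up l := (#|level l| <= r) && (beta (cut l) \subset [set u | l < e u - w u]).

Let e_ge u : u \in B0 -> w u <= e u.
Proof.
move=> uB; case: (eqVneq u u0) => [->|/(e_parent uB)[v [_ _ ->]]]; first by rewrite e_root.
exact: leq_addr.
Qed.

Let cutK l : #|level l| <= r -> #|cut l| <= K.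
Proof.
move=> h; apply: leq_trans (cardsU_leq _ _) _.
by apply: leq_trans (leq_add heavy_card h) _; rewrite /K; clear; lia.
Qed.

(** A path in the connected set [beta (cut l)] cannot jump over the removed level, so the whole set
    lies on one side of it. *)
Let down l : #|level l| <= r -> ~~ up l -> beta (cut l) \subset [set u | e u <= l].
Proof.
move=> lr; rewrite /up lr /= => /subsetPn[u uB]; rewrite inE -leqNgt => ul.
have B0cut v : v \in beta (cut l) -> (v \in B0) && ((e v <= l) || (l < e v - w v)).
  move=> vB; have vB0 : v \in B0 by apply: subsetP vB; apply: beta_sub (cutK lr) _; apply: subsetUl.
  have : v \notin level l.
    by move/(subsetP (beta_in (cutK lr))): vB; rewrite in_setD in_setU negb_or => /andP[/andP[]].
  by rewrite inE vB0 /= negb_and -ltnNge -leqNgt orbC.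
apply/subsetP => v vB; rewrite inE; have /connectP[p] := beta_conn (cutK lr) uB vB.
have : e u <= l by case/andP: (B0cut u uB) => _ /orP[//|]; rewrite ltnNge ul.
elim: p u {ul} uB => [|v' p IH] u uB /= ul; first by move=> _ ->.
move=> /andP[/and3P[_ v'B uv'] v'p]; apply: IH => //.
case/andP: (B0cut u uB) => uB0 _; case/andP: (B0cut v' v'B) => v'B0 /orP[//|].
by rewrite touch_sym in uv'; have := e_le v'B0 uB0 uv'; move: ul; clear; lia.
Qed.

(** Only the root occupies level 0: every other interval starts at the distance of its parent, which
    is positive. *)
Let up0 : up 0.
Proof.
have h u : u \in B0 -> u != u0 -> 0 < e u - w u.
  move=> uB /(e_parent uB)[v [vB _ ->]]; rewrite addKn.
  by apply: leq_trans (e_ge vB); case/andP: (B0w vB).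
have l0 : #|level 0| <= r.
  apply: leq_trans r_gt0; rewrite -(cards1 u0); apply/subset_leq_card/subsetP => u.
  rewrite !inE leqNgt => /and3P[uB + _]; apply: contraR; exact: h.
rewrite /up l0; apply/subsetP => u uB; rewrite inE; apply: h.
  by apply: subsetP uB; apply: beta_sub (cutK l0) _; apply: subsetUl.
apply: contraTneq uB => ->; apply/negP => /(subsetP (beta_in (cutK l0))).
rewrite !inE u0B e_root subnn leq0n /=.
by case/andP: (B0w u0B) => -> _; rewrite orbT.
Qed.

Let up_bound l : up l -> l <= \sum_u e u.
Proof.
case/andP=> lr h; have /set0Pn[u uB] := beta_neq0 (cutK lr).
move/(subsetP h): uB; rewrite inE => lu; rewrite (bigD1 u) //=; move: lu; clear; lia.
Qed.

(** Otherwise these [r] levels would contain at least [r * r.+1] incidences, more than the total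
    weight [r ^ 2]. *)
Let window a : exists2 b, a < b <= a + r & #|level b| <= r.
Proof.
have [/existsP[i hi]|] := boolP [exists i : 'I_r, #|level (a.+1 + i)| <= r].
  by exists (a.+1 + i) => //; have := ltn_ord i; clear; lia.
rewrite negb_exists => /forallP h; exfalso.
have lo : r * r.+1 <= \sum_(i < r) #|level (a.+1 + i)|.
  rewrite -[X in X * _]card_ord -sum_nat_const; apply: leq_sum => i _.
  by have := h i; rewrite -ltnNge.
have hi : \sum_(i < r) #|level (a.+1 + i)| <= r ^ 2.
  apply: leq_trans weight_total; pose c i u := e u - w u <= a.+1 + i < e u.
  rewrite (eq_bigr (fun i : 'I_r => \sum_(u in B0) c i u)); last first.
    move=> i _; rewrite -sum1dep_card big_mkcondr; apply: eq_bigr => u _.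
    by rewrite /c; case: ifP.
  rewrite exchange_big [X in _ <= X](bigID (mem B0)) /=.
  apply: leq_trans (leq_addr _ _).
  rewrite [X in _ <= X](eq_bigl (mem B0)) => [|u]; last first.
    by rewrite andbC; apply: andb_idr => /B0E.
  apply: leq_sum => u uB; apply: leq_trans (interval_count r a.+1 (e u - w u) (w u)).
  by apply: leq_sum => l _; rewrite /c subnK // e_ge.
by have := leq_trans lo hi; rewrite -mulnn; nia.
Qed.

Lemma root_absurd : False.
Proof.
(* The haven lies beyond [a] but, by maximality of [a], not beyond the next thin level [b]; removing
   both levels traps it in between. *)
have [a upa amax] := ex_maxnP (ex_intro _ 0 up0) up_bound.
have [b /andP[ab bar] lb] := window a.
have nb : ~~ up b by apply/negP => /amax; rewrite leqNgt ab.
case/andP: upa => la upa.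
pose Z0 := cut a :|: level b.
have cuta : #|cut a| <= 2 * r.
  by apply: leq_trans (cardsU_leq _ _) _; have := heavy_card; move: la; clear; lia.
have Z0r : #|Z0| <= 3 * r.
  by apply: leq_trans (cardsU_leq _ _) _; move: cuta lb; clear; lia.
have Z0K : #|Z0| <= K by apply: leq_trans Z0r _; rewrite leq_mul2r orbT.
pose B1 := beta Z0.
have B1P u : u \in B1 -> [/\ u \in B0, a < e u - w u & e u <= b].
  move=> uB; split.
  - apply: subsetP uB; apply: beta_sub => //; rewrite /Z0 -setUA; exact: subsetUl.
  - have : u \in beta (cut a) by apply: subsetP uB; apply: beta_sub => //; apply: subsetUl.
    by move/(subsetP upa); rewrite inE.
  - have : u \in beta (cut b).
      apply: subsetP uB; apply: beta_sub => //; rewrite /Z0 /cut.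
      by rewrite setUAC; apply: subsetUl.
    by move/(subsetP (down lb nb)); rewrite inE.
pose x0 := head (0, 0) (S u0).
have x0S : x0 \in S u0.
  by rewrite /x0; case: (S u0) (S_string u0) => [//|z s] _; rewrite inE eqxx.
(* A walk to the root may meet strings of [B1] only if they are recorded in [D]. *)
pose avoids (D : {set T}) z := forall q, q \in B1 -> q \notin D -> z \notin S q.
have avoids_sub (D D' : {set T}) z : D \subset D' -> avoids D z -> avoids D' z.
  by move=> DD' h q qB qD; apply: h => //; apply: contra qD; apply: subsetP.
(* The walk follows the parents down to the root. By [e_le], a string with [e u <= a] touches no
   string of [B1]; any other one records its at most [w u] neighbours. Since [e] drops by [w u] at
   each step, these weights telescope to [e u - a], with an excess of at most [r] for the string
   reaching level [a]. *)
have descent n u : e u < n -> u \in B0 -> forall x, x \in S u ->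
    exists2 D : {set T}, walk_in (avoids D) x x0 &
      #|D| <= (if e u <= a then 0 else e u - a + r).
  elim: n u => // n IH u eun uB x xS.
  pose Du := if e u <= a then set0 else [set v in E | touch S u v].
  have avu z : z \in S u -> avoids Du z.
    move=> zu q qB qD; apply/negP => zq; have [qB0 aq _] := B1P q qB.
    have uq : touch S u q by apply/hasP; exists z.
    move: qD; rewrite /Du; case: leqP => ea; last by rewrite inE B0E //= uq.
    by rewrite touch_sym in uq; have := e_le qB0 uB uq; move: ea aq; clear; lia.
  have Duc : #|Du| <= if e u <= a then 0 else w u.
    by rewrite /Du; case: ifP; rewrite ?cards0.
  have wr : w u <= r by case/andP: (B0w uB).
  have [uu0|uu0] := eqVneq u u0.
    exists Du; last by apply: leq_trans Duc _; case: ifP => // _; apply: leq_trans wr _; apply: leq_addl.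
    by apply: walk_in_sub (string_walk (S_string u) xS _); rewrite // uu0.
  have [v [vB uv ev]] := e_parent uB uu0; have [z zu zv] := hasP uv.
  have wv : 0 < w u by case/andP: (B0w uB).
  have evn : e v < n by move: eun ev wv; clear; lia.
  have [D' wD' D'c] := IH v evn vB z zv.
  exists (Du :|: D').
    apply: walk_in_trans (walk_in_sub _ wD'); last by move=> t; apply: avoids_sub (subsetUr _ _).
    apply: walk_in_sub (string_walk (S_string u) xS zu) => t /avu.
    exact: avoids_sub (subsetUl _ _).
  apply: leq_trans (cardsU_leq _ _) _; move: Duc D'c ev wr.
  by case: (leqP (e u) a) => h1; case: (leqP (e v) a) => h2; move: h1 h2; clear; lia.
pose good x (D : {set T}) := [/\ Z0 \subset D, #|D| <= 5 * r & walk_in (avoids D) x x0].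
(* Take any grid walk to the root and leave it at the first string of [B1], to descend from there.
   The size is [3 * r] for [Z0] plus [(b - a) + r <= 2 * r] for the descent. *)
have goodP x : exists D, good x D.
  have [p [xp lp _]] := grid_walk x x0.
  elim: p x xp lp => [|y p IH] x /= xp lp;
    have [/exists_inP[u uB xu]|] := boolP [exists u in B1, x \in S u].
  1,3: have [uB0 au ub] := B1P u uB; have [D wD Dc] := descent _ u (leqnn _) uB0 x xu;
    exists (Z0 :|: D); split; [exact: subsetUl| |
      by apply: walk_in_sub wD => z; apply: avoids_sub (subsetUr _ _)];
    by apply: leq_trans (cardsU_leq _ _) _; move: Dc Z0r ub bar; case: ifP => _; clear; lia.
  - move/exists_inPn => h; exists Z0; split=> //; first by apply: leq_trans Z0r _; rewrite leq_mul2r orbT.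
    by rewrite -lp; apply: walk_in_refl => q qB _; apply: h.
  - move/exists_inPn => h; case/andP: xp => xy yp.
    have [D [ZD Dc wD]] := IH y yp lp; exists D; split=> //.
    by apply: walk_in_step xy wD => q qB _; apply: h.
have [D00 [ZD00 D00c wD00]] := goodP (0, 0).
pose border x := [|| x.1 == 0, x.1 == N, x.2 == 0 | x.2 == N].
have pDP x : exists pD : seq (nat * nat) * {set T},
    [/\ path gadj x pD.1, last x pD.1 = x0,
       (forall z, z \in x :: pD.1 -> avoids pD.2 z),
       (Z0 \subset pD.2) && (#|pD.2| <= 5 * r) & border x -> pD.2 = D00].
  have [bx|nbx] := boolP (border x).
    (* No string meets the border, so border vertices first walk along it to the corner and all
       share [D00]. *)
    have : walk_in (avoids D00) x x0.
      apply: walk_in_trans wD00; apply: walk_in_sub (border_walk bx) => z bz q _ _.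
      by apply/negP => /S_inner; move: bz; clear; lia.
    by case=> p [xp lp h]; exists (p, D00); rewrite /= ZD00 D00c.
  have [D [ZD Dc [p [xp lp h]]]] := goodP x.
  by exists (p, D); rewrite /= ZD Dc.
have [pD {}pDP] := choice pDP.
apply: (@no_grid_haven T S N K x0 (fun x => (pD x).1) (fun x => (pD x).2) beta) => //.
- by move=> x; case: (pDP x).
- by move=> x; case: (pDP x).
- by move=> x; case: (pDP x) => _ _ _ /andP[_ h] _; rewrite /K; move: h; clear; lia.
- move=> x bx; case: (pDP x) => _ _ _ _ -> //.
  by case: (pDP (0, 0)) => _ _ _ _ ->.
(* A string of [beta Z] lies in [B1] because [Z] contains [Z0], and outside the recorded set because
   [Z] contains it; hence the walk misses it. *)
- move=> x Z u z ZK DZ uZ zu; case: (pDP x) => _ _ h /andP[ZD _] _.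
  apply/negP => /h av; have := av u; rewrite zu => av'.
  have uZ0 : u \in B1 by apply: subsetP uZ; apply: beta_sub => //; apply: subset_trans DZ.
  have uD : u \notin (pD x).2.
    by move/(subsetP (beta_in ZK)): uZ; rewrite inE => /andP[+ _]; apply: contra; apply: subsetP.
  by have := av' uZ0 uD.
Qed.

End Root.

Lemma no_string_haven : False.
Proof.
have /set0Pn[u0 u0B] : B0 != set0 := beta_neq0 heavyK.
have [u uB|e [e1 e2 e3]] := @weighted_distance T (touch S) w B0 u0 u0B; first exact: connB0.
exact: root_absurd u0B e1 e2 e3.
Qed.

End StringHaven.

Definition component (T : finType) (t : rel T) (X : {set T}) (u : T) : {set T} :=
  [set v | connect (inside t X) u v].

Section Component.
Variables (T : finType) (t : rel T).
Hypothesis t_sym : symmetric t.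

Lemma inside_sym (X : {set T}) : symmetric (inside t X).
Proof. by move=> a b; rewrite /inside /= t_sym andbCA. Qed.

Lemma component_refl (X : {set T}) u : u \in component t X u.
Proof. by rewrite inE connect0. Qed.

Lemma component_eq (X : {set T}) u v : v \in component t X u -> component t X v = component t X u.
Proof.
rewrite inE => uv; apply/setP => z; rewrite !inE.
exact: esym (same_connect (sym_connect_sym (@inside_sym X)) uv _).
Qed.

Lemma component_sub (X : {set T}) u : u \in X -> component t X u \subset X.
Proof.
move=> uX; apply/subsetP => v; rewrite inE => /connectP[p].
elim: p u uX => [|z p IH] u uX /=; first by move=> _ ->.
by move=> /andP[/and3P[_ zX _] zp]; apply: IH.
Qed.

Lemma component_touch (X : {set T}) u v : u \in X -> v \in X -> t u v -> v \in component t X u.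
Proof. by move=> uX vX uv; rewrite inE connect1 //= /inside /= uX vX. Qed.

Lemma component_mono (X Y : {set T}) u : X \subset Y -> component t X u \subset component t Y u.
Proof.
move=> XY; apply/subsetP => v; rewrite !inE; apply: connect_sub => a b /and3P[aX bX ab].
by apply: connect1; rewrite /inside /= ab !(subsetP XY).
Qed.

Lemma component_connected (X : {set T}) u : u \in X ->
  {in component t X u &, forall a b, connect (inside t (component t X u)) a b}.
Proof.
move=> uX a b au bu; set C := component t X u.
have : connect (inside t X) a b.
  by have := component_eq au; rewrite -/C => E; have : b \in component t X a by [rewrite E]; rewrite inE.
case/connectP => p; elim: p a {bu} au => [|z p IH] a au /=; first by move=> _ ->; apply: connect0.
move=> /andP[/and3P[aX zX az] zp] bl.
have zC : z \in C by rewrite /C -(component_eq au) component_touch.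
apply: connect_trans (IH z zC zp bl).
by apply: connect1; rewrite /inside /= au zC az.
Qed.

End Component.

(** Without such a [Z], every small set leaves a component with more than half of the weight. Two
    such components must intersect, so they are nested and form a haven. *)
Lemma string_separator (T : finType) (S : T -> seq (nat * nat)) (N r : nat) (E : {set T}) :
  (forall u, is_string (S u)) ->
  (forall u (z : nat * nat), z \in S u -> [&& 0 < z.1, z.1 < N, 0 < z.2 & z.2 < N]) ->
  0 < r -> \sum_(u in E) weight S E u <= r ^ 2 ->
  exists Z : {set T}, #|Z| <= 20 * r /\ forall u, u \in E :\: Z ->
    2 * (\sum_(v in component (touch S) (E :\: Z) u) weight S E v)
      <= \sum_(v in E) weight S E v.
Proof.
move=> Sstr Sin r0 tot; apply: contrapT => nosep.
pose big Z u := \sum_(v in E) weight S E v <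
   2 * (\sum_(v in component (touch S) (E :\: Z) u) weight S E v).
pose beta Z := if [pick u in E :\: Z | big Z u] is Some u
  then component (touch S) (E :\: Z) u else set0.
have tsym : symmetric (touch S) by apply: touch_sym.
have betaP (Z : {set T}) : #|Z| <= 20 * r ->
    exists u, [/\ u \in E :\: Z, big Z u & beta Z = component (touch S) (E :\: Z) u].
  move=> Zr; rewrite /beta; case: pickP => [u /andP[uZ ub]|h]; first by exists u.
  exfalso; apply: nosep; exists Z; split=> // u uZ.
  by have := h u; rewrite /= uZ /= /big ltnNge => /negbFE.
apply: (@no_string_haven T S N r E beta) => //.
- by move=> Z /betaP[u [uE _ ->]]; apply: component_sub.
- move=> Z /betaP[u [uE _ ->]]; apply/set0Pn; exists u; exact: component_refl.
- move=> Y Z Zr YZ; have Yr : #|Y| <= 20 * r by apply: leq_trans Zr; apply: subset_leq_card.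
  have [u [uZ ub ->]] := betaP Z Zr; have [v [vY vb ->]] := betaP Y Yr.
  set A := component _ _ u; set B := component _ _ v.
  have AE : A \subset E by apply: subset_trans (component_sub _ uZ) (subsetDl _ _).
  have BE : B \subset E by apply: subset_trans (component_sub _ vY) (subsetDl _ _).
  have [/pred0P h|/pred0Pn[z /andP[/= zA zB]]] := boolP [disjoint A & B].
    exfalso; move: ub vb; rewrite /big -/A -/B.
    suff : \sum_(x in A) weight S E x + \sum_(x in B) weight S E x
      <= \sum_(x in E) weight S E x by clear; lia.
    rewrite [leqRHS](bigID (mem A)) /= leq_add //.
      rewrite [leqRHS](eq_bigl (mem A)) // => x.
      by rewrite andbC; apply: andb_idr => /(subsetP AE).
    rewrite [leqRHS](bigID (mem B)) /=.
    apply: leq_trans (leq_addr _ _); rewrite [leqRHS](eq_bigl (mem B)) // => x /=.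
    case xB : (x \in B); last by rewrite andbF.
    have := h x; rewrite /= xB !andbT => ->.
    by rewrite (subsetP BE).
  rewrite /A /B -(component_eq tsym zA) -(component_eq tsym zB).
  by apply: component_mono; apply: setDS.
- move=> Z /betaP[u [uE _ ->]]; exact: component_connected.
Qed.

(** * From separators to cutwidth *)

Definition rank_cut (V : finType) (E : {set {set V}}) (rho : V -> nat) (t : nat) : nat :=
  #|[set A in E | [exists x in A, rho x < t] && [exists y in A, t <= rho y]]|.

Section Recursion.
Variables (V : finType) (S : {set V} -> seq (nat * nat)) (N : nat) (E0 : {set {set V}}).
Hypothesis S_string : forall A, is_string (S A).
Hypothesis S_inner : forall A (z : nat * nat), z \in S A ->
  [&& 0 < z.1, z.1 < N, 0 < z.2 & z.2 < N].
Hypothesis S_touch : forall (A B : {set V}) x, A \in E0 -> B \in E0 ->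
  x \in A -> x \in B -> touch S A B.

Let mass (E : {set {set V}}) := \sum_(A in E) weight S E A.
(** Step [i] handles masses below [2 ^ i.+1], hence at most [r ^ 2] for [r = 2 ^ uphalf i.+1], and
    removes at most [20 * r] edges. *)
Let bound k := \sum_(i < k) 20 * 2 ^ uphalf i.+1.

(** The components are ranked in consecutive blocks. Edges with a common end touch, so every vertex
    lies in one block, and a threshold cuts, besides edges of [Z], only edges of a single
    component. *)
Lemma glue_ranks (E Z : {set {set V}}) (l : nat) : E \subset E0 ->
  (forall A, A \in E :\: Z -> exists rho, injective rho /\
     forall t, rank_cut (component (touch S) (E :\: Z) A) rho t <= l) ->
  exists rho, injective rho /\ forall t, rank_cut E rho t <= #|Z| + l.
Proof.
move=> EE0 h; set X := E :\: Z.
have XE0 A : A \in X -> A \in E0 by rewrite inE => /andP[_ /(subsetP EE0)].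
have /choice[R RP] : forall C, exists rho : V -> nat, injective rho /\
    forall A, A \in X -> C = component (touch S) X A -> forall t, rank_cut C rho t <= l.
  move=> C.
  have [[A [AX ->]]|no] := pselect (exists A, A \in X /\ C = component (touch S) X A).
    by have [rho [ri rl]] := h A AX; exists rho.
  exists (fun v => nat_of_ord (enum_rank v)); split; first by move=> u v /val_inj/enum_rank_inj.
  by move=> A AX E1; case: no; exists A.
pose kap v : {set {set V}} := if [pick A in X | v \in A] is Some A
  then component (touch S) X A else set0.
have kapP v A : A \in X -> v \in A -> kap v = component (touch S) X A.
  move=> AX vA; rewrite /kap; case: pickP => [B /andP[BX vB]|/(_ A)]; last by rewrite AX vA.
  apply: component_eq; first exact: touch_sym.
  by apply: component_touch => //; apply: (@S_touch A B v) => //; apply: XE0.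
pose big := (\max_v R (kap v) v).+1.
have Rbig v : R (kap v) v < big by rewrite ltnS (@leq_bigmax V (fun v => R (kap v) v)).
pose idx C := nat_of_ord (enum_rank (C : {set {set V}})).
pose rho v := idx (kap v) * big + R (kap v) v.
have rho_div v : rho v %/ big = idx (kap v) by rewrite divnMDl // divn_small ?addn0.
exists rho; split.
  move=> u v uv; have ek : kap u = kap v.
    by apply/enum_rank_inj/val_inj; have := rho_div u; rewrite uv rho_div.
  by move: uv; rewrite /rho ek => /addnI; apply: (RP _).1.
move=> t; rewrite /rank_cut.
pose Q := [set A in X | [exists x in A, rho x < t] && [exists y in A, t <= rho y]].
have sub : [set A in E | [exists x in A, rho x < t] && [exists y in A, t <= rho y]]
    \subset Z :|: Q.
  by apply/subsetP => A; rewrite !inE => /andP[-> ->]; rewrite !andbT; case: (A \in Z).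
apply: leq_trans (subset_leq_card sub) _; apply: leq_trans (cardsU_leq _ _) _.
rewrite leq_add2l.
(* A cut edge satisfies [rho x <= t.-1 < rho y] with both ranks in one block, so dividing [t.-1] by
   the block length identifies the block. *)
have QP A : A \in Q -> let C := component (touch S) X A in
  [/\ A \in X, idx C = t.-1 %/ big, [exists x in A, R C x < t - idx C * big] &
    [exists x in A, t - idx C * big <= R C x]].
  rewrite inE => /and3P[AX /exists_inP[x xA xt] /exists_inP[y yA yt]] C.
  have kx : kap x = C by apply: kapP.
  have ky : kap y = C by apply: kapP.
  move: (Rbig x) (Rbig y) xt yt; rewrite /rho kx ky => bx by_ xt yt.
  split=> //.
  - have -> : t.-1 = idx C * big + (t.-1 - idx C * big) by move: xt; clear; lia.
    rewrite divnMDl // divn_small ?addn0 //; move: xt yt by_; clear; lia.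
  - by apply/exists_inP; exists x => //; move: xt; clear; lia.
  - by apply/exists_inP; exists y => //; move: yt; clear; lia.
have [->|/set0Pn[A0 A0Q]] := eqVneq Q set0; first by rewrite cards0.
have [A0X i0 _ _] := QP A0 A0Q; set C := component (touch S) X A0 in i0.
apply: leq_trans ((RP C).2 A0 A0X erefl (t - idx C * big)).
apply/subset_leq_card/subsetP => A AQ; have [AX i1 c1 c2] := QP A AQ.
have E1 : component (touch S) X A = C by apply/enum_rank_inj/val_inj; exact: etrans i1 (esym i0).
by rewrite inE -{1}E1 component_refl -E1 c1 c2.
Qed.

Lemma rank_exists k (E : {set {set V}}) : E \subset E0 -> mass E < 2 ^ k ->
  exists rho : V -> nat, injective rho /\ forall t, rank_cut E rho t <= bound k.
Proof.
elim: k E => [|k IH] E EE0 Ek.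
  exists (fun v => nat_of_ord (enum_rank v)); split; first by move=> u v /val_inj/enum_rank_inj.
  move=> t; suff -> : E = set0 by apply: leq_trans (leq0n _); rewrite leqn0 cards_eq0;
    apply/eqP/setP => A; rewrite !inE.
  (* Every string touches itself, so a nonempty family has positive mass. *)
  apply/eqP; apply: contraLR Ek => /set0Pn[A AE].
  rewrite expn0 -leqNgt /mass (bigD1 A) //=; apply: leq_trans (leq_addr _ _).
  apply/card_gt0P; exists A; rewrite inE AE /=; apply/hasP.
  by case: (S A) (S_string A) => [//|z s] _; exists z; rewrite inE eqxx.
set r := 2 ^ uphalf k.+1.
have Er : mass E <= r ^ 2.
  apply: leq_trans (ltnW Ek) _; rewrite -expnM leq_exp2l //; clear; lia.
have [//|Z [Zr Zc]] := string_separator S_string S_inner _ Er; first by rewrite expn_gt0.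
have [|rho [ri rl]] := @glue_ranks E Z (bound k) EE0.
  move=> A AX; apply: IH.
    by apply: subset_trans (component_sub _ AX) _; apply: subset_trans (subsetDl _ _) EE0.
  set C := component _ _ _.
  have CE : C \subset E by apply: subset_trans (component_sub _ AX) (subsetDl _ _).
  have le : mass C <= \sum_(v in C) weight S E v.
    apply: leq_sum => B BC; apply/subset_leq_card/subsetP => D.
    by rewrite inE => /andP[DC h]; rewrite inE (subsetP CE _ DC).
  have := Zc A AX; rewrite -/C -/(mass E); move: le Ek; rewrite expnS; clear; lia.
exists rho; split=> // t; apply: leq_trans (rl t) _.
by rewrite /bound big_ord_recr /= addnC leq_add2l.
Qed.

(** The summands double every second step, hence the induction on two consecutive values. The
    predecessor makes the bound vanish at [k = 0], the case of a graph without edges. *)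
Lemma bound_le k : bound k <= 80 * (2 ^ uphalf k).-1.
Proof.
have boundS j : bound j.+1 = bound j + 20 * 2 ^ uphalf j.+1 by rewrite /bound big_ord_recr.
suff : bound k + 80 <= 80 * 2 ^ uphalf k /\ bound k.+1 + 80 <= 80 * 2 ^ uphalf k.+1.
  by case=> h _; move: h; clear; lia.
elim: k => [|k [IH1 IH2]]; first by rewrite boundS /bound big_ord0.
split=> //; rewrite !boundS.
have -> : 2 ^ uphalf k.+2 = 2 * 2 ^ uphalf k by rewrite -expnS.
have h : 2 ^ uphalf k.+1 <= 2 * 2 ^ uphalf k by rewrite -expnS leq_exp2l //; lia.
by move: IH1 h; clear; lia.
Qed.

Corollary string_ranking k : mass E0 < 2 ^ k ->
  exists rho : V -> nat, injective rho /\
    forall t, rank_cut E0 rho t <= 80 * (2 ^ uphalf k).-1.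
Proof.
move=> /(rank_exists (subxx E0))[rho [ri rl]]; exists rho; split=> // t.
exact: leq_trans (rl t) (bound_le k).
Qed.

End Recursion.

From mathcomp Require Import all_order all_algebra ring lra.
From mathcomp Require Import all_classical all_reals all_analysis.
Import Order.TTheory GRing.Theory Num.Theory.
Import numFieldNormedType.Exports.

(** * Discretization of curves *)

Lemma near_column_walk (P : nat * nat -> Prop) i j j' :
  j <= j'.+1 -> j' <= j.+1 -> P (i, j) -> P (i, j') -> walk_in P (i, j) (i, j').
Proof.
move=> h h' Pj Pj'; have [->|n] := eqVneq j j'; first exact: walk_in_refl.
apply: (walk_in_step Pj _ (walk_in_refl Pj')).
by rewrite /gadj /= eqxx /=; apply/orP; left; lia.
Qed.

Lemma near_row_walk (P : nat * nat -> Prop) i i' j :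
  i <= i'.+1 -> i' <= i.+1 -> P (i, j) -> P (i', j) -> walk_in P (i, j) (i', j).
Proof.
move=> h h' Pj Pj'; have [->|n] := eqVneq i i'; first exact: walk_in_refl.
apply: (walk_in_step Pj _ (walk_in_refl Pj')).
by rewrite /gadj /= eqxx /=; apply/orP; right; lia.
Qed.

Section Discretization.
Local Open Scope ring_scope.
Local Open Scope classical_set_scope.
Variable R : realType.
Implicit Types (X Y : R -> R).

Lemma truncn_near (x y : R) : 0 <= x -> 0 <= y -> `|x - y| < 1 ->
  (Num.truncn x <= (Num.truncn y).+1)%N.
Proof.
move=> x0 y0 xy; rewrite -ltnS truncn_lt_nat //.
have := truncnS_gt y; rewrite -!natr1.
by move: xy; rewrite ltr_norml => /andP[_]; lra.
Qed.

Lemma truncn_dist (x : R) : 0 <= x -> `|(Num.truncn x)%:R - x| <= 1.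
Proof.
move=> x0; have /andP[h1 h2] := truncn_itv x0; move: h2; rewrite -natr1 => h2.
by rewrite ler_norml; lra.
Qed.

(** Truncation costs 1 per coordinate; the tolerance is 2 because the corner turned between two
    nearby grid points mixes the coordinates of two parameters. *)
Definition near_curve X Y (z : nat * nat) : Prop :=
  [/\ (0 < z.1)%N, (0 < z.2)%N &
    exists t, `|z.1%:R - X t| <= 2 /\ `|z.2%:R - Y t| <= 2].

Definition grid_point X Y t : nat * nat := (Num.truncn (X t), Num.truncn (Y t)).

Lemma grid_curve_step X Y s t : (forall t, 1 <= X t) -> (forall t, 1 <= Y t) ->
  `|X s - X t| < 1 -> `|Y s - Y t| < 1 ->
  walk_in (near_curve X Y) (grid_point X Y s) (grid_point X Y t).
Proof.
move=> X1 Y1 hX hY.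
have X0 u : 0 <= X u by apply: le_trans (X1 u).
have Y0 u : 0 <= Y u by apply: le_trans (Y1 u).
have tX : (0 < Num.truncn (X t))%N by rewrite truncn_gt0.
have tX' : (0 < Num.truncn (X s))%N by rewrite truncn_gt0.
have tY : (0 < Num.truncn (Y t))%N by rewrite truncn_gt0.
have tY' : (0 < Num.truncn (Y s))%N by rewrite truncn_gt0.
have := truncn_dist (X0 s); have := truncn_dist (X0 t).
have := truncn_dist (Y0 s); have := truncn_dist (Y0 t); move=> dYt dYs dXt dXs.
have Ps : near_curve X Y (grid_point X Y s) by split=> //; exists s => /=; split; lra.
have Pt : near_curve X Y (grid_point X Y t) by split=> //; exists t => /=; split; lra.
have Pst : near_curve X Y (Num.truncn (X t), Num.truncn (Y s)).
  split=> //; exists s; split => /=; last by lra.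
  apply: le_trans (ler_distD (X t) _ _) _; rewrite [X in _ + X]distrC; lra.
have hX' := hX; have hY' := hY; rewrite distrC in hX'; rewrite distrC in hY'.
apply: (walk_in_trans (y := (Num.truncn (X t), Num.truncn (Y s)))).
  by apply: near_row_walk => //; apply: truncn_near.
by apply: near_column_walk => //; apply: truncn_near.
Qed.

(** The parameters whose grid point is reachable from that of [a] form a nonempty open and closed
    subset of the connected line. *)
Lemma grid_curve X Y (a b : R) : continuous X -> continuous Y ->
  (forall t, 1 <= X t) -> (forall t, 1 <= Y t) ->
  walk_in (near_curve X Y) (grid_point X Y a) (grid_point X Y b).
Proof.
move=> cX cY X1 Y1.
pose g := grid_point X Y; pose B := [set t | walk_in (near_curve X Y) (g a) (g t)].
have near_step t : \forall s \near t, walk_in (near_curve X Y) (g t) (g s).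
  have hX : \forall s \near t, `|X t - X s| < 1 by move/cvgrPdist_lt: (cX t) => /(_ _ ltr01).
  have hY : \forall s \near t, `|Y t - Y s| < 1 by move/cvgrPdist_lt: (cY t) => /(_ _ ltr01).
  by near=> s; apply: grid_curve_step => //; near: s.
have oB : open B.
  rewrite openE => t Bt; apply: filterS (near_step t) => s; exact: walk_in_trans.
have cB : closed B.
  rewrite -openC openE => t nBt; apply: filterS (near_step t) => s ts Bs.
  by apply: nBt; apply: walk_in_trans Bs _; apply: walk_in_sym.
have sT : connected [set: R] by apply/connected_intervalP.
have BT : B = [set: R].
  apply: sT.
  - by exists a; apply: grid_curve_step; rewrite ?subrr ?normr0.
  - by exists B; rewrite // setTI.
  - by exists B; rewrite // setTI.
by have : B b by rewrite BT.
Unshelve. all: by end_near.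
Qed.

(** Extends curves from the unit interval to the whole line, so that continuity needs no subspace
    topology. *)
Definition clamp (t : R) : R := Num.max 0 (Num.min 1 t).

Lemma clamp_itv t : `[0, 1] (clamp t).
Proof.
rewrite /clamp /= in_itv /= le_max lexx /= ge_max ler01 /=.
by rewrite ge_min lexx.
Qed.

Lemma clamp_id t : `[0, 1] t -> clamp t = t.
Proof.
rewrite /clamp /= in_itv /= => /andP[t0 t1].
by rewrite (min_idPr t1) (max_idPr t0).
Qed.

Lemma clamp_continuous : continuous clamp.
Proof.
move=> t; apply: continuous_max; first exact: cst_continuous.
by apply: continuous_min; [exact: cst_continuous | exact: cvg_id].
Qed.

Lemma continuous_clamp (U : topologicalType) (f : R -> U) :
  {within `[0, 1], continuous f} -> continuous (f \o clamp).
Proof.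
move=> /subspace_continuousP cf t.
apply: (@cvg_comp _ _ _ clamp f _ (within `[0, 1] (nbhs (clamp t)))).
  move=> W h; have {}h : nbhs t (clamp @^-1` [set x | `[0, 1] x -> W x]).
    exact: clamp_continuous h.
  by apply: filterS h => s; apply; exact: clamp_itv.
exact: cf (clamp_itv t).
Qed.

Lemma finite_bound (T : finType) (P : T -> nat -> Prop) :
  (forall x m n, (m <= n)%N -> P x m -> P x n) -> (forall x, exists n, P x n) ->
  exists n, forall x, P x n.
Proof.
move=> mono /choice[f fP]; exists (\max_x f x)%N => x.
exact: mono (leq_bigmax x) (fP x).
Qed.

Lemma continuous_lower_bound (f : R -> R) : continuous f ->
  exists M : nat, forall t, `[0, 1] t -> 1 <= f t + M%:R.
Proof.
move=> cf; have /(EVT_min ler01)[c _ cmin] : {within `[0, 1], continuous f}.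
  exact: continuous_subspaceT.
exists (Num.truncn (1 - f c)).+1 => t t01; have := cmin t t01.
by have := truncnS_gt (1 - f c); lra.
Qed.

(** By compactness the distance between the two curves has a positive minimum, and [m] exceeds its
    inverse. *)
Lemma disjoint_gap (f1 f2 g1 g2 : R -> R) :
  continuous f1 -> continuous f2 -> continuous g1 -> continuous g2 ->
  (forall s t, `[0, 1] s -> `[0, 1] t -> ~ (f1 s = g1 t /\ f2 s = g2 t)) ->
  exists m : nat, forall s t, `[0, 1] s -> `[0, 1] t ->
    1 < m%:R * (`|f1 s - g1 t| + `|f2 s - g2 t|).
Proof.
move=> cf1 cf2 cg1 cg2 dis.
pose F (q : R * R) : R := `|f1 q.1 - g1 q.2| + `|f2 q.1 - g2 q.2|.
have cF : continuous F.
  move=> q.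
  have h (a b : R -> R) : continuous a -> continuous b ->
      (fun q : R * R => `|a q.1 - b q.2| : R) @ q --> `|a q.1 - b q.2|.
    move=> ca cb; apply: cvg_norm; apply: cvgB.
      exact: (continuous_comp (f := fst) (@cvg_fst _ _ _ _ _) (ca _)).
    exact: (continuous_comp (f := snd) (@cvg_snd _ _ _ _ _) (cb _)).
  by apply: cvgD; apply: h.
have cK : compact (`[0, 1]%classic `*` `[0, 1]%classic : set (R * R)).
  by apply: compact_setX; apply: segment_compact.
have K0 : (`[0, 1]%classic `*` `[0, 1]%classic : set (R * R)) !=set0.
  by exists (0, 0); split; rewrite /= in_itv /= lexx ler01.
have [[s0 t0]] := compact_EVT_min K0 cK (continuous_subspaceT cF).
rewrite inE => -[/= s01 t01] Fmin.
have Fpos : 0 < F (s0, t0).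
  rewrite lt_def addr_ge0 // andbT; apply/eqP => /eqP.
  rewrite /F /= paddr_eq0 // !normr_eq0 !subr_eq0 => /andP[/eqP e1 /eqP e2].
  exact: dis s01 t01 (conj e1 e2).
exists (Num.truncn (F (s0, t0))^-1).+1 => s t hs ht.
have : F (s0, t0) <= F (s, t) by apply: Fmin; rewrite inE.
have := truncnS_gt (F (s0, t0))^-1; set m := _.+1%:R => hm hF.
apply: lt_le_trans (ler_wpM2l _ hF); last by rewrite /m ler0n.
by rewrite mulrC -ltr_pdivrMl // mulr1.
Qed.

Lemma curve_strings (T : finType) (E : {set T}) (c : T -> R -> R * R) :
  (forall A, A \in E -> {within `[0, 1], continuous (c A)}) ->
  exists (N : nat) (S : T -> seq (nat * nat)),
  [/\ (forall A, is_string (S A)),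
    (forall A (z : nat * nat), z \in S A -> [&& 0 < z.1, z.1 < N, 0 < z.2 & z.2 < N]%N),
    (forall A B, A \in E -> B \in E -> touch S A B -> arc_of (c A) `&` arc_of (c B) !=set0) &
    (forall A B (a b : bool), A \in E -> B \in E -> c A a%:R = c B b%:R -> touch S A B)].
Proof.
move=> cc.
pose f A : R -> R * R := if A \in E then c A \o clamp else cst (0, 0).
have fc A : continuous (f A).
  by rewrite /f; case: ifP => [/cc/continuous_clamp //|_]; apply: cst_continuous.
have f_clamp A t : f A (clamp t) = f A t.
  by rewrite /f; case: ifP => //= _; rewrite (clamp_id (clamp_itv t)).
have f_end A (a : bool) : A \in E -> f A a%:R = c A a%:R.
  move=> AE; rewrite /f AE /= clamp_id //= in_itv /=.
  by case: a; rewrite ?lexx ?ler01.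
pose x A t := (f A t).1; pose y A t := (f A t).2.
have xc A : continuous (x A).
  by move=> t; apply: (continuous_comp (f := f A) (g := fst)); [exact: fc|exact: cvg_fst].
have yc A : continuous (y A).
  by move=> t; apply: (continuous_comp (f := f A) (g := snd)); [exact: fc|exact: cvg_snd].
(* Translating by [M] makes all coordinates positive, as the grid requires. *)
have [M MP] : exists M, forall A, forall t, 1 <= x A t + M%:R /\ 1 <= y A t + M%:R.
  apply: finite_bound => [A m n mn h t|A].
    by have [h1 h2] := h t; split; [apply: le_trans h1 _|apply: le_trans h2 _];
      rewrite lerD2l ler_nat.
  have [m1 h1] := continuous_lower_bound (xc A).
  have [m2 h2] := continuous_lower_bound (yc A).
  exists (m1 + m2)%N => t; have := h1 _ (clamp_itv t); have := h2 _ (clamp_itv t).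
  rewrite /x /y f_clamp natrD; have := ler0n R m1; have := ler0n R m2; lra.
have [m mP] : exists m : nat, forall AB : T * T, ~ (arc_of (f AB.1) `&` arc_of (f AB.2) !=set0) ->
    forall s t, 1 < m%:R * (`|x AB.1 s - x AB.2 t| + `|y AB.1 s - y AB.2 t|).
  apply: finite_bound => [AB m n mn h dis s t|[A B]].
    by apply: lt_le_trans (h dis s t) _; rewrite ler_wpM2r ?addr_ge0 ?ler_nat.
  have [nd|dis] := pselect (arc_of (f A) `&` arc_of (f B) !=set0).
    by exists 0%N => h; case: h.
  have [|m h] := disjoint_gap (xc A) (yc A) (xc B) (yc B).
    move=> s t s01 t01 [e1 e2]; apply: dis; exists (f A s); split; first by exists s.
    by exists t => //; rewrite [f A s]surjective_pairing -/(x A s) -/(y A s) e1 e2 -surjective_pairing.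
  exists m => _ s t; have := h _ _ (clamp_itv s) (clamp_itv t).
  by rewrite /x /y !f_clamp.
(* A common grid vertex brings two scaled curves within 4 in each coordinate, thus 8 in sum, while
   the scale [k] keeps disjoint curves more than 8 apart. *)
pose k := (8 * m).+1; have k1 : 1 <= k%:R :> R by rewrite ler1n.
pose X A t := k%:R * (x A t + M%:R); pose Y A t := k%:R * (y A t + M%:R).
have Xc A : continuous (X A).
  by move=> t; apply: cvgM; [exact: cvg_cst | apply: cvgD; [exact: xc|exact: cvg_cst]].
have Yc A : continuous (Y A).
  by move=> t; apply: cvgM; [exact: cvg_cst | apply: cvgD; [exact: yc|exact: cvg_cst]].
have X1 A t : 1 <= X A t by rewrite /X; have [h _] := MP A t; apply: le_trans (h) _; rewrite ler_peMl // (le_trans ler01 h).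
have Y1 A t : 1 <= Y A t by rewrite /Y; have [_ h] := MP A t; apply: le_trans (h) _; rewrite ler_peMl // (le_trans ler01 h).
have /choice[p pP] : forall A, exists p, [/\ path gadj (grid_point (X A) (Y A) 0) p,
    last (grid_point (X A) (Y A) 0) p = grid_point (X A) (Y A) 1 &
    forall z, z \in grid_point (X A) (Y A) 0 :: p -> near_curve (X A) (Y A) z].
  by move=> A; apply: grid_curve.
pose S A := grid_point (X A) (Y A) 0 :: p A.
have near A z : z \in S A -> near_curve (X A) (Y A) z by case: (pP A) => _ _; apply.
pose N := (\max_A \max_(z <- S A) maxn z.1 z.2).+1%N.
exists N, S; split.
- by move=> A; case: (pP A).
- move=> A z zS; have [-> -> _] := near A z zS => /=.
  have : (maxn z.1 z.2 < N)%N.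
    rewrite ltnS; apply: leq_trans (leq_bigmax A).
    by have := @leq_bigmax_seq _ (S A) xpredT (fun z : nat * nat => maxn z.1 z.2) z zS isT.
  by rewrite gtn_max => /andP[-> ->].
- move=> A B AE BE /hasP[z zA zB].
  have fE C : C \in E -> arc_of (f C) `<=` arc_of (c C).
    move=> CE q [t t01 <-]; exists t => //.
    by rewrite /f CE /= clamp_id.
  suff [q [qA qB]] : arc_of (f A) `&` arc_of (f B) !=set0.
    by exists q; split; apply: fE.
  apply: contrapT => /(mP (A, B)) h.
  have [_ _ [s [s1 s2]]] := near A z zA; have [_ _ [t [t1 t2]]] := near B z zB.
  have d1 : k%:R * `|x A s - x B t| <= 4.
    have -> : k%:R * `|x A s - x B t| = `|X A s - X B t|.
      by rewrite -[k%:R in LHS]normr_nat -normrM /X; congr `|_|; ring.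
    apply: le_trans (ler_distD z.1%:R _ _) _.
    by rewrite [X in X + _ <= _]distrC; lra.
  have d2 : k%:R * `|y A s - y B t| <= 4.
    have -> : k%:R * `|y A s - y B t| = `|Y A s - Y B t|.
      by rewrite -[k%:R in LHS]normr_nat -normrM /Y; congr `|_|; ring.
    apply: le_trans (ler_distD z.2%:R _ _) _.
    by rewrite [X in X + _ <= _]distrC; lra.
  have := h s t => /=; set dx := `|x A s - x B t| in d1 *; set dy := `|y A s - y B t| in d2 *.
  have dx0 : 0 <= dx := normr_ge0 _.
  have dy0 : 0 <= dy := normr_ge0 _.
  have e d : (8 * m%:R + 1) * d = 8 * (m%:R * d) + d :> R by ring.
  by move: d1 d2; rewrite /k -natr1 natrM !e mulrDr; lra.
- move=> A B a b AE BE cAB.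
  have ends C (e : bool) : grid_point (X C) (Y C) e%:R \in S C.
    case: e; last by rewrite inE eqxx.
    by have [_ <- _] := pP C; apply: mem_last.
  apply/hasP; exists (grid_point (X A) (Y A) a%:R); first exact: ends.
  have -> : grid_point (X A) (Y A) a%:R = grid_point (X B) (Y B) b%:R.
    by rewrite /grid_point /X /Y /x /y !f_end // cAB.
  exact: ends.
Qed.

End Discretization.

(** * Cutwidth of a drawn graph *)

(** Sorting by [rho] gives the ordering: the vertices before [ofun i] are those of rank below
    [rho (ofun i)]. *)
Lemma cutwidth_rank (G : sgraph) (rho : G -> nat) (l : nat) : injective rho ->
  (forall t, rank_cut (edges G) rho t <= l) -> cutwidth G <= l.
Proof.
move=> rho_inj rho_l; rewrite /cutwidth; case: ex_minnP => w _; apply.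
pose below x := [set y | rho y < rho x].
have cnt_lt x : #|below x| < #|G|.
  rewrite -cardsT; apply/proper_card/properP; split; first exact/finset.subsetT.
  by exists x; rewrite ?inE ?ltnn.
pose cnt x := Ordinal (cnt_lt x).
have cntE x y : (cnt x < cnt y) = (rho x < rho y).
  have mono u v : rho u < rho v -> cnt u < cnt v.
    move=> uv; apply/proper_card/properP; split.
      by apply/fintype.subsetP => z; rewrite !inE => /ltn_trans; apply.
    by exists u; rewrite ?inE ?ltnn.
  case: (ltngtP (rho x) (rho y)) => [/mono //|/mono h|/rho_inj->]; last by rewrite ltnn.
  by rewrite ltnNge ltnW.
have cnt_inj : injective cnt.
  move=> x y xy; apply: rho_inj; apply/eqP.
  by rewrite eqn_leq leqNgt -cntE xy ltnn leqNgt -cntE xy ltnn.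
have [ofun oK Ko] : bijective cnt by apply: inj_card_bij => //; rewrite card_ord.
apply/existsP; exists (finfun ofun); apply/andP; split.
  by apply/injectiveP => i j; rewrite !ffunE => /(can_inj Ko).
apply/forallP => i; apply/implyP => _; apply: leq_trans (rho_l (rho (ofun i))).
set s := [set finfun ofun j | j : 'I_#|G| & j < i].
have inS x : (x \in s) = (rho x < rho (ofun i)).
  rewrite -cntE Ko; apply/imsetP/idP => [[j]|h].
    by rewrite inE ffunE => ji ->; rewrite Ko.
  by exists (cnt x); rewrite ?inE ?ffunE ?oK.
rewrite /cut_size /rank_cut; apply/eq_leq/eq_card => A; rewrite !inE.
congr (_ && (_ && _)); apply: eq_existsb => x; rewrite inS //.
by rewrite -leqNgt.
Qed.

Section DrawingCut.
Variables (R : realType) (G : sgraph) (d : drawing R G).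

Let share (A B : {set G}) := [exists x, (x \in A) && (x \in B)].

Lemma arc_cases A p : A \in edges G -> arc_of (curve d A) p ->
  (exists2 x, x \in A & p = vertex_point d x) \/ open_arc_of (curve d A) p.
Proof.
move=> AE [s s01 <-]; have [u [v [-> c0 c1]]] := curve_ends d AE.
move: s01; rewrite /= in_itv /= => /andP[s0 s1].
have [->|sn0] := eqVneq s 0%R; first by left; exists u; rewrite ?inE ?eqxx.
have [->|sn1] := eqVneq s 1%R; first by left; exists v; rewrite ?inE ?eqxx ?orbT.
by right; exists s => //; rewrite /= in_itv /= !lt_neqAle eq_sym sn0 s0 sn1.
Qed.

Lemma arcs_meet A B : A \in edges G -> B \in edges G ->
  (arc_of (curve d A) `&` arc_of (curve d B) !=set0)%classic ->
  share A B \/ edges_cross d A B.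
Proof.
move=> AE BE [p [pA pB]].
have [[x xA px]|oA] := arc_cases AE pA.
  left; apply/existsP; exists x; rewrite xA /=; apply: contrapT => /negP xB.
  by have := @curve_avoid _ _ d B x BE xB; rewrite -px.
have [[x xB px]|oB] := arc_cases BE pB; last by right; exists p.
left; apply/existsP; exists x; rewrite xB andbT; apply: contrapT => /negP xA.
by have := @curve_avoid _ _ d A x AE xA; rewrite -px.
Qed.

(** At most [deg x ^ 2] ordered pairs of edges, including the pairs [(A, A)], share the vertex
    [x]. *)
Lemma share_count :
  \sum_(A in edges G) #|[set B in edges G | share A B]| <= ssqd G.
Proof.
have degE (x : G) : #|[set A in edges G | x \in A]| <= deg x.
  apply: (@leq_trans #|[set [set x; y]%SET | y in [set y | adj x y]]|); last exact: leq_imset_card.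
  apply/subset_leq_card/fintype.subsetP => A; rewrite !inE.
  move=> /andP[/existsP[u /existsP[v /andP[uv /eqP->]]]]; rewrite !inE => /orP[/eqP->|/eqP->].
    by apply/imsetP; exists v; rewrite ?inE.
  by apply/imsetP; exists u; rewrite ?inE 1?adj_sym // finset.setUC.
apply: (@leq_trans (\sum_(x : G) #|[set A in edges G | x \in A]| ^ 2)); last first.
  by apply: leq_sum => x _; rewrite leq_exp2r.
have -> : \sum_(x : G) #|[set A in edges G | x \in A]| ^ 2 =
    \sum_(A in edges G) \sum_(x in A) #|[set B in edges G | x \in B]|.
  rewrite [RHS](exchange_big_dep predT) //=; apply: eq_bigr => x _.
  rewrite sum_nat_const -mulnn; congr (_ * _).
  by apply: eq_card => A; rewrite inE.
apply: leq_sum => A AE.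
apply: (@leq_trans #|\bigcup_(x in A) [set B in edges G | x \in B]|); last first.
  apply: (big_ind2 (fun (X : {set {set G}}) n => #|X| <= n)); rewrite ?cards0 //.
  by move=> X1 n1 X2 n2 h1 h2; apply: leq_trans (cardsU_leq _ _) (leq_add h1 h2).
apply/subset_leq_card/fintype.subsetP => B; rewrite inE => /andP[BE /existsP[x /andP[xA xB]]].
by apply/bigcupP; exists x; rewrite // inE BE.
Qed.

Lemma cross_count :
  \sum_(A in edges G) #|[set B in edges G | (A != B) && `[< edges_cross d A B >]]|
    <= 2 * #|crossing_pairs d|.
Proof.
apply: (@leq_trans (\sum_(A in edges G) #|[set P in crossing_pairs d | A \in P]|)).
  apply: leq_sum => A AE; rewrite -(card_in_imset (f := fun B => [set A; B]%SET)).
    apply/subset_leq_card/fintype.subsetP => _ /imsetP[B + ->].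
    rewrite inE => /and3P[BE AB cr]; rewrite inE set21 andbT inE.
    apply/existsP; exists A; rewrite AE /=; apply/existsP; exists B.
    by rewrite BE AB eqxx.
  move=> B C; rewrite 2!inE => /and3P[_ AB _] /and3P[_ AC _] /setP/(_ B).
  by rewrite !inE eqxx orbT eq_sym (negPf AB) => /esym/eqP.
apply: (@leq_trans (\sum_(P in crossing_pairs d) #|P|)).
  have -> : \sum_(P in crossing_pairs d) #|P| =
     \sum_(A : {set G}) #|[set P in crossing_pairs d | A \in P]|.
    under eq_bigr do rewrite -sum1_card.
    rewrite (exchange_big_dep predT) //=; apply: eq_bigr => A _.
    by rewrite sum1dep_card.
  by rewrite [leqRHS](bigID (mem (edges G))) /= leq_addr.
rewrite mulnC -sum_nat_const; apply: leq_sum => P; rewrite inE.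
move=> /existsP[A /andP[_ /existsP[B /andP[_ /and3P[_ /eqP-> _]]]]].
by rewrite cards2; case: eqP.
Qed.

Lemma drawing_cutwidth :
  cutwidth G ^ 2 <= 160 ^ 2 * (2 * #|crossing_pairs d| + ssqd G).
Proof.
have [N [S [Sstr Sin Smeet Send]]] := curve_strings (curve_cont (d := d)).
have Stouch (A B : {set G}) x : A \in edges G -> B \in edges G ->
    x \in A -> x \in B -> touch S A B.
  have ends C : C \in edges G -> x \in C ->
      exists e : bool, curve d C (e%:R)%R = vertex_point d x.
    move=> CE; have [u [v [-> c0 c1]]] := curve_ends d CE.
    by rewrite !inE => /orP[]/eqP->; [exists false|exists true].
  move=> AE BE /(ends A AE)[a ea] /(ends B BE)[b eb].
  by apply: (Send A B a b) => //; rewrite ea eb.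
set m := 2 * #|crossing_pairs d| + ssqd G.
have mass_le : \sum_(A in edges G) weight S (edges G) A <= m.
  apply: leq_trans (leq_add cross_count share_count); rewrite -big_split /=.
  apply: leq_sum => A AE; apply: leq_trans (cardsU_leq _ _).
  apply/subset_leq_card/fintype.subsetP => B; rewrite inE => /andP[BE AB]; rewrite 3!inE BE /=.
  have [sh|nsh] := boolP (share A B); first by rewrite orbT.
  rewrite orbF; case: (arcs_meet AE BE (Smeet A B AE BE AB)) => [h|h]; first by rewrite h in nsh.
  rewrite asboolT // andbT; apply: contraNneq nsh => <-.
  have [u [v [Auv _ _]]] := curve_ends d AE.
  by apply/existsP; exists u; rewrite Auv !inE eqxx.
(* For [m = 0] the choice [k = 0] makes the ranking bound zero. *)
have [k mk km] : exists2 k, m < 2 ^ k & 2 ^ k <= 2 * m \/ k = 0.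
  case: (posnP m) => [->|m0]; first by exists 0; last right.
  exists (trunc_log 2 m).+1; first exact: trunc_log_ltn.
  by left; rewrite expnS leq_mul2l /= trunc_logP.
have [rho [ri rl]] := string_ranking Sstr Sin Stouch (leq_ltn_trans mass_le mk).
have := cutwidth_rank ri rl; move: km => [km|->]; last first.
  by rewrite /= leqn0 => /eqP->.
move=> h; apply: (@leq_trans ((80 * 2 ^ uphalf k) ^ 2)).
  by rewrite leq_exp2r //; apply: leq_trans h _; rewrite leq_mul2l leq_pred.
have hk : (2 ^ uphalf k) ^ 2 <= 2 * 2 ^ k.
  by rewrite -expnM -expnS leq_exp2l //; clear; lia.
(* Two factors 2 are lost, one in rounding up [k / 2] and one in rounding [m] up to a power of 2;
   together they turn [80 ^ 2] into [160 ^ 2]. *)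
rewrite expnMn -[160]/(80 * 2) expnMn -mulnA leq_mul2l; apply/orP; right.
by move: (2 ^ k) ((2 ^ uphalf k) ^ 2) hk km; clear; lia.
Qed.

End DrawingCut.

(** * Existence of drawings *)

Local Open Scope ring_scope.

(** Over the integers a nonzero leading coefficient has absolute value at least 1, so a value of 100
    times the cube of the previous one outweighs the few remaining monomials, of degree at most 3 in
    smaller values. *)
Fixpoint fast (n : nat) : int := if n is k.+1 then 100 * (fast k * (fast k * fast k)) else 1.

Lemma fast_ge1 n : 1 <= fast n.
Proof.
elim: n => [//|n IH] /=; have h : 1 <= fast n * fast n by rewrite -[1]mulr1 ler_pM.
have : 1 <= fast n * (fast n * fast n) by rewrite -[1]mulr1 ler_pM.
lia.
Qed.

Lemma leq_fast i j : (i <= j)%N -> fast i <= fast j.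
Proof.
elim: j => [|j IH]; first by rewrite leqn0 => /eqP->.
rewrite leq_eqVlt => /orP[/eqP->//|/IH h]; apply: le_trans h _ => /=.
have h1 := fast_ge1 j; have h2 : 1 <= fast j * fast j by rewrite -[1]mulr1 ler_pM.
have : fast j * 1 <= fast j * (fast j * fast j) by rewrite ler_pM2l //; lia.
lia.
Qed.

Definition below (m x : int) : bool := (1 <= x) && (x <= m).

Lemma below_mul m x y : below m x -> below m y -> 0 <= x * y <= m * m.
Proof.
by move=> /andP[x1 xm] /andP[y1 ym]; rewrite mulr_ge0 ?ler_pM //; lia.
Qed.

Lemma below_mul3 m x y z : below m x -> below m y -> below m z ->
  0 <= x * (y * z) <= m * (m * m).
Proof.
move=> hx hy hz; have /andP[h1 h2] := below_mul hy hz; case/andP: hx => x1 xm.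
have x0 : 0 <= x by lia.
by apply/andP; split; [apply: mulr_ge0 | apply: ler_pM].
Qed.

Lemma mul_large (k z : int) : 0 <= z -> k != 0 -> z <= z * k \/ z * k <= - z.
Proof.
move=> z0 k0; have [k1|k1] : 1 <= k \/ k <= -1 by lia.
  by left; rewrite -[X in X <= _]mulr1 ler_wpM2l.
by right; rewrite -[X in _ <= X]mulrN1 ler_wpM2l.
Qed.

Lemma below_m m x : below m x -> m <= m * m /\ m * m <= m * (m * m).
Proof.
move=> /andP[x1 xm]; have m1 : 1 <= m by apply: le_trans xm.
have h : m * 1 <= m * m by rewrite ler_wpM2l //; lia.
have : m * m <= m * (m * m) by rewrite ler_wpM2l //; lia.
lia.
Qed.

(* Vanishes when the lines y = (a + b) x - a b, y = (c + d) x - c d and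
   y = (e + f) x - e f are concurrent. *)
Definition concur (a b c d e f : int) : int :=
  (a + b - (c + d)) * (c * d - e * f) - (c + d - (e + f)) * (a * b - c * d).

Section Core.
Variables (m : int).
Let big := 100 * (m * (m * m)).

Lemma sum_core a b c d : below m a -> below m b -> below m c -> big <= d -> a + b != c + d.
Proof.
move=> ha hb hc hd; have [h1 h2] := below_m ha; move: ha hb hc hd.
rewrite /below /big; lia.
Qed.

(** Equality would mean that the lines [ab] and [cd] meet on the vertical line through [e]. The
    coefficient of [e] in the difference is the difference of the slopes. *)
Lemma pencil_core_center a b c d e : below m a -> below m b -> below m c -> below m d ->
  big <= e -> a + b != c + d -> (e - a) * (e - b) != (e - c) * (e - d).
Proof.
move=> ha hb hc hd he ne; have [h1 h2] := below_m ha.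
have hab := below_mul ha hb; have hcd := below_mul hc hd.
have k0 : c + d - (a + b) != 0 by lia.
have e0 : 0 <= e by move: ha he; rewrite /below /big; lia.
have hk := mul_large e0 k0; rewrite -subr_eq0.
have -> : (e - a) * (e - b) - (e - c) * (e - d) = e * (c + d - (a + b)) + a * b - c * d by ring.
move: ha hab hcd hk he; rewrite /below /big; lia.
Qed.

(** The difference is linear in the dominant [a], with coefficient [b - e]. *)
Lemma pencil_core_side a b c d e : below m b -> below m c -> below m d -> below m e ->
  big <= a -> e != b -> (e - a) * (e - b) != (e - c) * (e - d).
Proof.
move=> hb hc hd he ha ne; have [h1 h2] := below_m hb.
have heb := below_mul he hb; have hec := below_mul he hc; have hed := below_mul he hd.
have hcd := below_mul hc hd.
have k0 : b - e != 0 by lia.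
have a0 : 0 <= a by move: ha hb; rewrite /below /big; lia.
have hk := mul_large a0 k0; rewrite -subr_eq0.
have -> : (e - a) * (e - b) - (e - c) * (e - d) = a * (b - e) - e * b + e * c + e * d - c * d by ring.
move: hb heb hec hed hcd hk ha; rewrite /below /big; lia.
Qed.

(** [concur] is linear in [f], and its leading coefficient compares the lines [ab] and [cd] at the
    abscissa [e]: for huge [f] the line [ef] is almost vertical there. *)
Lemma concur_core a b c d e f : below m a -> below m b -> below m c -> below m d -> below m e ->
  big <= f -> (e - a) * (e - b) != (e - c) * (e - d) -> concur a b c d e f != 0.
Proof.
move=> ha hb hc hd he hf ne; have [h1 h2] := below_m ha.
have := below_mul3 ha hc hd; have := below_mul3 hb hc hd; have := below_mul3 hc ha hb.
have := below_mul3 hd ha hb; have := below_mul3 he ha hb; have := below_mul3 he hc hd.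
have k0 : (e - a) * (e - b) - (e - c) * (e - d) != 0 by rewrite subr_eq0.
have f0 : 0 <= f by move: ha hf; rewrite /below /big; lia.
have hk := mul_large f0 k0.
have -> : concur a b c d e f = f * ((e - a) * (e - b) - (e - c) * (e - d))
  + a * (c * d) + b * (c * d) - c * (a * b) - d * (a * b) + e * (a * b) - e * (c * d).
  by rewrite /concur; ring.
move: h1 h2 ha hk hf; rewrite /below /big.
by move: (f * _) (a * (c * d)) (b * (c * d)) (c * (a * b)) (d * (a * b)) (e * (a * b)) (e * (c * d)); clear; lia.
Qed.

End Core.

Lemma fast_below n i : (i <= n)%N -> below (fast n) (fast i).
Proof. by move=> h; rewrite /below fast_ge1 leq_fast. Qed.

Lemma fast_large n i : (n < i)%N -> 100 * (fast n * (fast n * fast n)) <= fast i.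
Proof. exact: (@leq_fast n.+1). Qed.

Lemma fast_inj : injective fast.
Proof.
suff h i j : (i < j)%N -> fast i < fast j.
  by move=> i j; case: (ltngtP i j) => [/h|/h|//]; lia.
move=> /fast_large hj; have hi := fast_below (leqnn i).
by have := below_m hi; move: hi hj; rewrite /below; lia.
Qed.

Lemma last_max s n : uniq (rcons s n) -> all (leq^~ n) s -> {in s, forall i, (i < n)%N}.
Proof.
rewrite rcons_uniq => /andP[ns _] /allP h i si; rewrite ltn_neqAle h // andbT.
by apply: contraNneq ns => <-.
Qed.

Lemma seq_max x s : exists2 n, n \in x :: s & all (leq^~ n) (x :: s).
Proof.
elim: s x => [|y s IH] x; first by exists x; rewrite /= ?leqnn ?inE.
have [n ns hn] := IH y; have [xn|nx] := leqP x n.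
  by exists n; [rewrite inE ns orbT | apply/andP].
exists x; first by rewrite inE eqxx.
apply/andP; split=> //; apply: sub_all hn => z zn.
exact: leq_trans zn (ltnW nx).
Qed.

(** The symmetries of the equation bring the largest index to the last place, where its value
    dominates. *)
Lemma fast_sum a b c d : uniq [:: a; b; c; d] -> fast a + fast b != fast c + fast d.
Proof.
have core i j k l : uniq [:: i; j; k; l] -> all (leq^~ l) [:: i; j; k] ->
    fast i + fast j != fast k + fast l.
  move=> u /(@last_max [:: i; j; k] l u); case: l {u} => [|l] h.
    by have := h i; rewrite inE eqxx => /(_ isT).
  have {}h m : m \in [:: i; j; k] -> below (fast l) (fast m) by move/h; rewrite ltnS => /fast_below.
  apply: (@sum_core (fast l));
    by [exact: fast_large | apply: h; rewrite !inE eqxx ?orbT].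
move=> u; have [n ns /= /and5P[ha hb hc hd _]] := seq_max a [:: b; c; d].
have reorder s : {subset [:: a; b; c; d] <= s} -> size s = 4%N -> uniq s.
  by move=> h hs; apply: (leq_size_uniq u) => //; rewrite hs.
move: ns; rewrite !inE => /or4P[]/eqP ?; subst n.
- rewrite eq_sym [X in _ != X]addrC; apply: core; last by rewrite /= ?hb ?hc ?hd.
  by apply: reorder => // x; rewrite !inE => /or4P[]->; rewrite ?orbT.
- rewrite eq_sym; apply: core; last by rewrite /= ?ha ?hc ?hd.
  by apply: reorder => // x; rewrite !inE => /or4P[]->; rewrite ?orbT.
- rewrite [X in _ != X]addrC; apply: core; last by rewrite /= ?ha ?hb ?hd.
  by apply: reorder => // x; rewrite !inE => /or4P[]->; rewrite ?orbT.
- by apply: core => //; rewrite /= ha hb hc.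
Qed.

Lemma fast_pencil a b c d e : uniq [:: a; b; c; d; e] ->
  (fast e - fast a) * (fast e - fast b) != (fast e - fast c) * (fast e - fast d).
Proof.
have side i j k l n : uniq [:: n; j; k; l; i] -> all (leq^~ i) [:: n; j; k; l] ->
    (fast n - fast i) * (fast n - fast j) != (fast n - fast k) * (fast n - fast l).
  move=> u /(@last_max [:: n; j; k; l] i u); case: i u => [|i] u h.
    by have := h n; rewrite inE eqxx => /(_ isT).
  have {}h m : m \in [:: n; j; k; l] -> below (fast i) (fast m) by move/h; rewrite ltnS => /fast_below.
  have nj : fast n != fast j.
    by apply: contraTneq u => /fast_inj->; rewrite /= inE eqxx.
  apply: (@pencil_core_side (fast i)) => //;
    by [exact: fast_large | apply: h; rewrite !inE eqxx ?orbT].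
move=> u; have [n ns /= /and5P[ha hb hc hd /andP[he _]]] := seq_max a [:: b; c; d; e].
have reorder s : {subset [:: a; b; c; d; e] <= s} -> size s = 5%N -> uniq s.
  by move=> h hs; apply: (leq_size_uniq u) => //; rewrite hs.
move: ns; rewrite !inE => /or4P[||| /orP[]]/eqP?; subst n.
- apply: side; last by rewrite /= ?hb ?hc ?hd ?he.
  by apply: reorder => // x; rewrite !inE => /or4P[||| /orP[]]->; rewrite ?orbT.
- rewrite [X in X != _]mulrC; apply: side; last by rewrite /= ?ha ?hc ?hd ?he.
  by apply: reorder => // x; rewrite !inE => /or4P[||| /orP[]]->; rewrite ?orbT.
- rewrite eq_sym; apply: side; last by rewrite /= ?hb ?ha ?hd ?he.
  by apply: reorder => // x; rewrite !inE => /or4P[||| /orP[]]->; rewrite ?orbT.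
- rewrite eq_sym [X in X != _]mulrC; apply: side; last by rewrite /= ?hb ?hc ?ha ?he.
  by apply: reorder => // x; rewrite !inE => /or4P[||| /orP[]]->; rewrite ?orbT.
- have s : fast a + fast b != fast c + fast d.
    by apply: fast_sum; move: u; rewrite (cat_uniq [:: a; b; c; d] [:: e]) => /andP[].
  have := @last_max [:: a; b; c; d] e u; rewrite /= ha hb hc hd => /(_ isT).
  case: e {u he ha hb hc hd reorder} => [|e] h; first by have := h a; rewrite inE eqxx => /(_ isT).
  have {}h m : m \in [:: a; b; c; d] -> below (fast e) (fast m) by move/h; rewrite ltnS => /fast_below.
  apply: (@pencil_core_center (fast e)) => //;
    by [exact: fast_large | apply: h; rewrite !inE eqxx ?orbT].
Qed.

Lemma fast_concur a b c d e f : uniq [:: a; b; c; d; e; f] ->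
  concur (fast a) (fast b) (fast c) (fast d) (fast e) (fast f) != 0.
Proof.
have core i j k l m n : uniq [:: i; j; k; l; m; n] -> all (leq^~ n) [:: i; j; k; l; m] ->
    concur (fast i) (fast j) (fast k) (fast l) (fast m) (fast n) != 0.
  move=> u /(@last_max [:: i; j; k; l; m] n u) h; have := u.
  rewrite (cat_uniq [:: i; j; k; l; m] [:: n]) => /andP[/fast_pencil p _].
  case: n {u} h => [|n] h; first by have := h i; rewrite inE eqxx => /(_ isT).
  have {}h q : q \in [:: i; j; k; l; m] -> below (fast n) (fast q) by move/h; rewrite ltnS => /fast_below.
  apply: (@concur_core (fast n)) => //;
    by [exact: fast_large | apply: h; rewrite !inE eqxx ?orbT].
have swap i j k l m n : concur i j k l m n = concur i j k l n m.
  by rewrite /concur; ring.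
have rot i j k l m n : concur i j k l m n = concur m n i j k l.
  by rewrite /concur; ring.
move=> u; have [n ns /= /and5P[ha hb hc hd /and3P[he hf _]]] := seq_max a [:: b; c; d; e; f].
have reorder s : {subset [:: a; b; c; d; e; f] <= s} -> size s = 6%N -> uniq s.
  by move=> h hs; apply: (leq_size_uniq u) => //; rewrite hs.
move: ns; rewrite !inE => /or4P[||| /or3P[]] /eqP?; subst n.
- rewrite rot rot swap; apply: core; last by rewrite /= ?ha ?hb ?hc ?hd ?he ?hf.
  by apply: reorder => // x; rewrite !inE => /or4P[||| /or3P[]]->; rewrite ?orbT.
- rewrite rot rot; apply: core; last by rewrite /= ?ha ?hb ?hc ?hd ?he ?hf.
  by apply: reorder => // x; rewrite !inE => /or4P[||| /or3P[]]->; rewrite ?orbT.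
- rewrite rot swap; apply: core; last by rewrite /= ?ha ?hb ?hc ?hd ?he ?hf.
  by apply: reorder => // x; rewrite !inE => /or4P[||| /or3P[]]->; rewrite ?orbT.
- rewrite rot; apply: core; last by rewrite /= ?ha ?hb ?hc ?hd ?he ?hf.
  by apply: reorder => // x; rewrite !inE => /or4P[||| /or3P[]]->; rewrite ?orbT.
- rewrite swap; apply: core; last by rewrite /= ?ha ?hb ?hc ?hd ?he ?hf.
  by apply: reorder => // x; rewrite !inE => /or4P[||| /or3P[]]->; rewrite ?orbT.
- by apply: core => //; rewrite /= ?ha ?hb ?hc ?hd ?he ?hf.
Qed.

(** * Chords of a parabola *)

Section Chords.
Local Open Scope classical_set_scope.
Variable R : realType.
Implicit Types (p q x s : R) (z : R * R).

(* The chord of the parabola y = x^2 between the abscissas [p] and [q]. *)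
Definition chord p q s : R * R :=
  (p + s * (q - p), (p + q) * (p + s * (q - p)) - p * q).

Definition on_line p q z : Prop := z.2 = (p + q) * z.1 - p * q.

Lemma chord_arc p q z : p != q ->
  arc_of (chord p q) z <-> on_line p q z /\ (z.1 - p) * (z.1 - q) <= 0.
Proof.
move=> pq; have qp : q - p != 0 by rewrite subr_eq0 eq_sym.
have sq : 0 < (q - p) ^+ 2 by rewrite exprn_even_gt0.
split=> [[s /= + <-]|[]].
  rewrite in_itv /= => /andP[s0 s1]; split; first by rewrite /on_line /chord.
  rewrite /= (_ : _ * _ = - (s * (1 - s) * (q - p) ^+ 2)); last by ring.
  rewrite oppr_le0; apply: mulr_ge0; last exact: ltW.
  by apply: mulr_ge0; rewrite ?subr_ge0.
case: z => x y; rewrite /on_line /= => -> xpq.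
exists ((x - p) / (q - p)); last by rewrite /chord divfK // addrC subrK.
have : 0 <= (x - p) / (q - p) * (1 - (x - p) / (q - p)).
  have -> : (x - p) / (q - p) * (1 - (x - p) / (q - p)) =
      - ((x - p) * (x - q)) / (q - p) ^+ 2 by field.
  by apply: divr_ge0; [rewrite oppr_ge0 | exact: ltW].
by set t := (x - p) / _; rewrite /= in_itv /=; nra.
Qed.

Lemma chord_open_arc p q z : p != q ->
  open_arc_of (chord p q) z -> on_line p q z /\ (z.1 - p) * (z.1 - q) < 0.
Proof.
move=> pq; have qp : q - p != 0 by rewrite subr_eq0 eq_sym.
have sq : 0 < (q - p) ^+ 2 by rewrite exprn_even_gt0.
move=> [s /= + <-]; rewrite in_itv /= => /andP[s0 s1].
split; first by rewrite /on_line /chord.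
rewrite /= (_ : _ * _ = - (s * (1 - s) * (q - p) ^+ 2)); last by ring.
rewrite oppr_lt0; apply: mulr_gt0 => //.
by apply: mulr_gt0; rewrite ?subr_gt0.
Qed.

Lemma pair_continuous (T : topologicalType) (f g : T -> R) :
  continuous f -> continuous g -> continuous (fun t => (f t, g t)).
Proof. by move=> cf cg t; exact: cvg_pair (cf t) (cg t). Qed.

Lemma affine_continuous (u v w : R) : continuous (fun z : R * R => u * z.1 + v * z.2 + w).
Proof.
move=> z; apply: cvgD; last exact: cvg_cst.
by apply: cvgD; apply: cvgM; [exact: cvg_cst|exact: cvg_fst|exact: cvg_cst|exact: cvg_snd].
Qed.

Lemma chord_continuous p q : continuous (chord p q).
Proof.
have c1 : continuous (fun s : R => p + s * (q - p)).
  by move=> s; apply: cvgD; [exact: cvg_cst | apply: cvgM; [exact: cvg_id | exact: cvg_cst]].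
apply: pair_continuous => // s.
by apply: cvgB; [apply: cvgM; [exact: cvg_cst | exact: c1] | exact: cvg_cst].
Qed.

Lemma between_open p q : open [set z : R * R | (z.1 - p) * (z.1 - q) < 0].
Proof.
apply: (@open_comp _ _ (fun z : R * R => (z.1 - p) * (z.1 - q)) [set t : R | t < 0]); last exact: open_lt.
move=> z _; apply: cvgM; (apply: cvgB; [exact: cvg_fst | exact: cvg_cst]).
Qed.

(** The straightening [h] takes the equations of the two lines as coordinates; it is an affine
    bijection because the slopes differ. The neighborhood is a vertical strip in which each chord
    coincides with its line. *)
Lemma chords_cross p q p' q' z : p != q -> p' != q' -> p + q != p' + q' ->
  on_line p q z -> on_line p' q' z ->
  (z.1 - p) * (z.1 - q) < 0 -> (z.1 - p') * (z.1 - q') < 0 ->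
  cross_at (arc_of (chord p q)) (arc_of (chord p' q')) z.
Proof.
move=> pq pq' ss l l' b b'.
have d0 : p + q - (p' + q') != 0 by rewrite subr_eq0.
pose h (w : R * R) := ((- (p' + q')) * w.1 + 1 * w.2 + p' * q', (- (p + q)) * w.1 + 1 * w.2 + p * q).
pose kx (w : R * R) := (p + q - (p' + q'))^-1 * w.1 + (- (p + q - (p' + q'))^-1) * w.2
  + (p * q - p' * q') / (p + q - (p' + q')).
pose k w : R * R := (kx w, w.2 + (p + q) * kx w - p * q).
have hc : continuous h by apply: pair_continuous; apply: affine_continuous.
have kxc : continuous kx by apply: affine_continuous.
have kc : continuous k.
  apply: pair_continuous => // w.
  apply: cvgB; last exact: cvg_cst.
  by apply: cvgD; [exact: cvg_snd | apply: cvgM; [exact: cvg_cst | exact: kxc]].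
have hk w : k (h w) = w.
  by case: w => x y; rewrite /k /kx /h /=; congr pair; field.
have kh w : h (k w) = w.
  by case: w => x y; rewrite /k /kx /h /=; congr pair; field.
have hz : h z = (0, 0).
  by rewrite /h; move: l l'; rewrite /on_line => l l'; congr pair; [rewrite l' | rewrite l]; ring.
pose U := [set w : R * R | (w.1 - p) * (w.1 - q) < 0] `&` [set w | (w.1 - p') * (w.1 - q') < 0].
have Uo : open U by apply: openI; apply: between_open.
have Uz : U z by split.
exists U, (k @^-1` U), h, k; split; last split.
- split=> //; split; last by rewrite -hz /= hk.
  by apply: open_comp Uo => w _; apply: kc.
- split.
  + by move=> w Uw; rewrite /= hk.
  + by move=> w.
  + by move=> w _; rewrite hk.
  + by move=> w _; rewrite kh.
- split; [exact: continuous_subspaceT | exact: continuous_subspaceT | |].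
  + move=> w [wb _]; rewrite chord_arc // /on_line /h /=; split.
      by move=> [-> _]; ring.
    by move=> e; split; [lra | exact: ltW].
  + move=> w [_ wb]; rewrite chord_arc // /on_line /h /=; split.
      by move=> [-> _]; ring.
    by move=> e; split; [lra | exact: ltW].
Qed.

End Chords.

(** * The drawing with straight edges *)

Section DrawingExists.
Local Open Scope classical_set_scope.
Variables (R : realType) (G : sgraph).

Let idx (x : G) : nat := enum_rank x.
Let a (x : G) : R := (fast (idx x))%:~R.

Let idx_inj : injective idx.
Proof. by move=> x y /val_inj/enum_rank_inj. Qed.

Let a_inj : injective a.
Proof. by move=> x y /intr_inj/fast_inj/idx_inj. Qed.

Let a_neq x y : x != y -> a x != a y.
Proof. by apply: contraNneq => /a_inj->. Qed.

Let a_concur x y z t u v : uniq [:: x; y; z; t; u; v] ->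
  (a x + a y - (a z + a t)) * (a z * a t - a u * a v)
  - (a z + a t - (a u + a v)) * (a x * a y - a z * a t) != 0.
Proof.
move=> un; have := @fast_concur (idx x) (idx y) (idx z) (idx t) (idx u) (idx v).
rewrite (map_inj_uniq idx_inj [:: x; y; z; t; u; v]) => /(_ un).
by rewrite /concur -(intr_eq0 R) !(rmorphB, rmorphM, rmorphD).
Qed.

(** An edge is an unordered pair, so an orientation is picked. *)
Definition straight_edge (A : {set G}) : R -> R * R :=
  if [pick e : G * G | adj e.1 e.2 && (A == [set e.1; e.2]%SET)] is Some e
  then chord (a e.1) (a e.2) else fun=> (0, 0).

Lemma straight_edgeP A : A \in edges G -> exists x y,
  [/\ x != y, A = [set x; y]%SET & straight_edge A = chord (a x) (a y)].
Proof.
rewrite inE => /existsP[u /existsP[v uv]]; rewrite /straight_edge; case: pickP => [[x y]|/(_ (u, v))].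
  move=> /andP[/= xy /eqP AE]; exists x, y; split=> //.
  by apply: contraTneq xy => ->; rewrite adj_irr.
by rewrite /= uv.
Qed.

Let on_line_vertex x y z : on_line (a x) (a y) (a z, a z ^+ 2) -> z = x \/ z = y.
Proof.
rewrite /on_line /= => e; have : (a z - a x) * (a z - a y) == 0 by apply/eqP; lra.
by rewrite mulf_eq0 !subr_eq0 => /orP[]/eqP/a_inj; [left|right].
Qed.

Let vertex_on_line x y : on_line (a x) (a y) (a x, a x ^+ 2) /\
  on_line (a x) (a y) (a y, a y ^+ 2).
Proof. by rewrite /on_line /=; split; ring. Qed.

(** Lines of equal slope with a common point coincide, and a line meets the parabola in at most two
    points, so the edges would be equal. *)
Let sums_neq x y x' y' z : x != y -> x' != y' -> [set x; y]%SET != [set x'; y']%SET ->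
  on_line (a x) (a y) z -> on_line (a x') (a y') z -> a x + a y != a x' + a y'.
Proof.
move=> xy xy' ne l l'; apply: contraNneq ne => e.
have pe : a x * a y = a x' * a y' by move: l l'; rewrite /on_line e; lra.
have le w : on_line (a x) (a y) w = on_line (a x') (a y') w by rewrite /on_line e pe.
apply/eqP/setP => w; rewrite !inE; apply/orP/orP => -[]/eqP->.
- have := (vertex_on_line x y).1; rewrite le => /on_line_vertex[]->; rewrite eqxx; by [left|right].
- have := (vertex_on_line x y).2; rewrite le => /on_line_vertex[]->; rewrite eqxx; by [left|right].
- have := (vertex_on_line x' y').1; rewrite -le => /on_line_vertex[]->; rewrite eqxx; by [left|right].
- have := (vertex_on_line x' y').2; rewrite -le => /on_line_vertex[]->; rewrite eqxx; by [left|right].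
Qed.

(* Two chords with a common endpoint meet only there, hence not in their interiors. *)
Let disjoint_ends x y x' y' z : x != y -> x' != y' -> [set x; y]%SET != [set x'; y']%SET ->
  open_arc_of (chord (a x) (a y)) z -> open_arc_of (chord (a x') (a y')) z ->
  [&& x != x', x != y', y != x' & y != y'].
Proof.
move=> xy xy' ne /(chord_open_arc (a_neq xy))[l b] /(chord_open_arc (a_neq xy'))[l' _].
have ss := sums_neq xy xy' ne l l'.
have key w : (w == x) || (w == y) -> ~~ ((w == x') || (w == y')).
  move=> wxy; apply: contraTN b => wxy'.
  have lw : on_line (a x) (a y) (a w, a w ^+ 2).
    by case/orP: wxy => /eqP->; [exact: (vertex_on_line x y).1 | exact: (vertex_on_line x y).2].
  have lw' : on_line (a x') (a y') (a w, a w ^+ 2).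
    by case/orP: wxy' => /eqP->; [exact: (vertex_on_line x' y').1 | exact: (vertex_on_line x' y').2].
  have : (a x + a y - (a x' + a y')) * (z.1 - a w) == 0.
    by apply/eqP; move: l l' lw lw'; rewrite /on_line /=; lra.
  rewrite mulf_eq0 !subr_eq0 (negPf ss) => /eqP->.
  by case/orP: wxy => /eqP->; rewrite subrr ?mul0r ?mulr0 ltxx.
have := key x; have := key y; rewrite !eqxx orbT /= !negb_or.
by move=> /(_ isT)/andP[-> ->] /(_ isT)/andP[-> ->].
Qed.

Lemma drawing_exists : inhabited (drawing R G).
Proof.
have cE A : A \in edges G -> exists x y,
  [/\ x != y, A = [set x; y]%SET & straight_edge A = chord (a x) (a y)] by exact: straight_edgeP.
constructor; apply: (@Drawing R G (fun x => (a x, a x ^+ 2)) straight_edge).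
- by move=> x y [/a_inj].
- move=> A /cE[x [y [_ _ ->]]]; apply: continuous_subspaceT; exact: chord_continuous.
- move=> A /cE[x [y [xy _ ->]]] s t _ _ [+ _] => /addrI/mulIf; apply.
  by rewrite subr_eq0 eq_sym a_neq.
- move=> A /cE[x [y [xy -> ->]]]; exists x, y; split=> //; rewrite /chord; congr pair; ring.
- move=> A z /cE[x [y [xy -> ->]]] zA /(chord_arc _ (a_neq xy))[/on_line_vertex h _].
  by move: zA; case: h => ->; rewrite !inE eqxx ?orbT.
- move=> A B /cE[x [y [xy -> ->]]] /cE[x' [y' [xy' -> ->]]] ne.
  have [e|ss] := eqVneq (a x + a y) (a x' + a y').
    rewrite (_ : _ `&` _ = set0) // -subset0 => z.
    move=> [/(chord_arc _ (a_neq xy))[l _] /(chord_arc _ (a_neq xy'))[l' _]].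
    by have := sums_neq xy xy' ne l l'; rewrite e eqxx.
  pose x0 := (a x * a y - a x' * a y') / (a x + a y - (a x' + a y')).
  apply: (@sub_finite_set _ _ [set (x0, (a x + a y) * x0 - a x * a y)]); last exact: finite_set1.
  move=> [u v] [/(chord_arc _ (a_neq xy))[l _] /(chord_arc _ (a_neq xy'))[l' _]].
  move: l l'; rewrite /on_line /= => l l'.
  have -> : x0 = u.
    by rewrite /x0 -[RHS](mulfK (x := a x + a y - (a x' + a y'))) ?subr_eq0 //; congr (_ / _); lra.
  by rewrite l.
- move=> A B z /cE[x [y [xy -> ->]]] /cE[x' [y' [xy' -> ->]]] ne.
  move=> /(chord_open_arc (a_neq xy))[l b] /(chord_open_arc (a_neq xy'))[l' b'].
  by apply: chords_cross => //; [exact: a_neq|exact: a_neq|exact: sums_neq l'].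
- move=> A B C z /cE[x [y [xy -> ->]]] /cE[x' [y' [xy' -> ->]]] /cE[x2 [y2 [xy2 -> ->]]].
  move=> nAB nBC nAC zA zB zC.
  have un : uniq [:: x; y; x'; y'; x2; y2].
    have := disjoint_ends xy xy' nAB zA zB; have := disjoint_ends xy' xy2 nBC zB zC.
    have := disjoint_ends xy xy2 nAC zA zC.
    move=> /and4P[h1 h2 h3 h4] /and4P[h5 h6 h7 h8] /and4P[h9 h10 h11 h12].
    rewrite /= !inE !negb_or xy xy' xy2 h1 h2 h3 h4 h5 h6 h7 h8 h9 h10 h11 h12 //.
  (* At a common point, both differences of products are the differences of slopes times [z.1], so
     the concurrency expression vanishes. *)
  have /eqP := a_concur un; apply.
  have [l _] := chord_open_arc (a_neq xy) zA.
  have [l' _] := chord_open_arc (a_neq xy') zB.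
  have [l2 _] := chord_open_arc (a_neq xy2) zC.
  have e1 : (a x + a y - (a x' + a y')) * z.1 = a x * a y - a x' * a y'.
    by move: l l'; rewrite /on_line; lra.
  have e2 : (a x' + a y' - (a x2 + a y2)) * z.1 = a x' * a y' - a x2 * a y2.
    by move: l2 l'; rewrite /on_line; lra.
  by rewrite -e1 -e2; ring.
Qed.

End DrawingExists.

Theorem theorem2 (R : realType) :
  exists c : R, 0 < c /\
    forall G : sgraph,
      (cutwidth G)%:R <= c * Num.sqrt ((pcr R G)%:R + (ssqd G)%:R).
Proof.
(* Doubling 160 more than absorbs the factor 2 before the number of crossing pairs. *)
exists 320; split=> // G.
have [d0] := drawing_exists R G; have [[d <-] _] := pcrP d0.
set x := _ + _; have x0 : 0 <= x by rewrite addr_ge0.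
have -> : 320 = Num.sqrt (320 ^+ 2) :> R by rewrite sqrtr_sqr ger0_norm.
have -> : (cutwidth G)%:R = Num.sqrt ((cutwidth G)%:R ^+ 2) :> R.
  by rewrite sqrtr_sqr ger0_norm.
rewrite -sqrtrM ?exprn_ge0 // ler_wsqrtr // -natrX.
apply: (@le_trans _ _ (160 ^ 2 * (2 * #|crossing_pairs d| + ssqd G))%N%:R).
  by rewrite ler_nat drawing_cutwidth.
rewrite natrM natrX natrD natrM /x.
have := ler0n R #|crossing_pairs d|; have := ler0n R (ssqd G); lra.
Qed.
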